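(* Let $G=(V,E)$ be a finite simple connected undirected graph on $n$ vertices with cut parameters $\alpha\leq\beta$, and consider the generalized random shortest path metric on $G$. Let $\mathsf{NN}$ be the length of the tour computed by the nearest-neighbor heuristic and $\mathsf{TSP}$ the length of a shortest TSP tour. Then $\mathbb{E}[\mathsf{NN}]=O(1/\alpha)$ and $\mathbb{E}\left[\frac{\mathsf{NN}}{\mathsf{TSP}}\right]=O(\beta/\alpha)$.
   Context: Generalized random shortest path metric on $G$: each edge $e\in E$ independently receives a weight $w(e)\sim\mathrm{Exp}(1)$, and $d(u,v)$ is the minimum total weight of a $u$–$v$ path in $G$; the TSP instance is the complete graph on $V$ with distances $d$. Cut parameters: for $\varnothing\neq U\subsetneq V$ let $\delta(U)$ be the set of edges with exactly one endpoint in $U$ and $\mu_U=|U|(n-|U|)$; $\alpha=\min_U|\delta(U)|/\mu_U$, $\beta=\max_U|\delta(U)|/\mu_U$. Nearest-neighbor heuristic: start at some vertex $v_0$, repeatedly move from the current vertex to a nearest unvisited vertex, and finally return to $v_0$. The $O$-constants are absolute. *)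

(* Defs.v *)
(* MathComp / MathComp-Analysis *)
From HB Require Import structures.
From mathcomp Require Import all_boot all_order all_algebra.
From mathcomp Require Import all_classical all_reals all_analysis.
Set Implicit Arguments.
Unset Strict Implicit.
Unset Printing Implicit Defensive.
Import Order.TTheory GRing.Theory Num.Theory.
Import numFieldNormedType.Exports.
Local Open Scope classical_set_scope.
Local Open Scope ring_scope.

(* Finite simple connected undirected graphs are given by their adjacency
   relation; edges are two-element vertex sets. *)
Definition simple_connected_graph (V : finType) (e : rel V) : Prop :=
  [/\ symmetric e, irreflexive e & forall u v, connect e u v].

Definition edges (V : finType) (e : rel V) : {set {set V}} :=
  [set [set uv.1; uv.2] | uv : V * V in [pred uv | e uv.1 uv.2]]%SET.

Definition edge_cut (V : finType) (e : rel V) (U : {set V}) : {set {set V}} :=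
  [set A in edges e | #|A :&: U| == 1%N]%SET.

Definition cut_ratio (R : realType) (V : finType) (e : rel V) (U : {set V})
    : R :=
  #|edge_cut e U|%:R / (#|U| * (#|V| - #|U|))%N%:R.

(* Below, [inf] and [sup] are taken over finite sets, nonempty whenever
   1 < #|V| and the graph is connected: they are minima and maxima. *)
Definition cut_ratios (R : realType) (V : finType) (e : rel V) : set R :=
  [set cut_ratio R e U |
    U in [set U : {set V} | U != finset.set0 /\ U \proper finset.setT]].

Definition alpha (R : realType) (V : finType) (e : rel V) : R :=
  inf (cut_ratios e).

Definition beta (R : realType) (V : finType) (e : rel V) : R :=
  sup (cut_ratios e).

(* Total f-cost of the consecutive steps of the vertex sequence x :: p. *)
Definition walk_cost (R : realType) (V : finType) (f : V -> V -> R)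
    (x : V) (p : seq V) : R :=
  \sum_(c <- pairmap f x p) c.

(* The minimum is over u-v paths without repeated vertices, so that it exists
   whatever the sign of the weights (exponential weights are nonnegative only
   almost surely). *)
Definition sp_dist (R : realType) (V : finType) (e : rel V)
    (w : {set V} -> R) (u v : V) : R :=
  inf [set walk_cost (fun x y => w [set x; y]%SET) u p |
        p in [set p : seq V | [/\ path e u p, last u p = v & uniq (u :: p)]]].

(* A tour lists every vertex exactly once; the closing step back to the first
   vertex is implicit in the sequence and counted by [tour_length]. *)
Definition is_tour (V : finType) (s : seq V) : Prop := perm_eq s (enum V).

Definition tour_length (R : realType) (V : finType) (dist : V -> V -> R)
    (s : seq V) : R :=
  if s is x :: p then walk_cost dist x (rcons p x) else 0.

Definition tsp_length (R : realType) (V : finType) (dist : V -> V -> R) : R :=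
  inf [set tour_length dist s | s in [set s : seq V | is_tour s]].

(* The possible outputs of the nearest-neighbor heuristic, over all starting
   vertices and all ways of breaking ties: when the heuristic is at x, the
   unvisited vertices are those of y :: q, and it moves to y. *)
Definition is_nn_tour (R : realType) (V : finType) (dist : V -> V -> R)
    (s : seq V) : Prop :=
  is_tour s /\
  forall (p : seq V) (x y : V) (q : seq V), s = p ++ x :: y :: q ->
  forall z : V, z \in y :: q -> dist x y <= dist x z.

Definition mutually_independent (disp : measure_display)
    (T : measurableType disp) (R : realType) (P : probability T R)
    (I : finType) (D : {set I}) (X : I -> {RV P >-> R}) : Prop :=
  forall J : {set I}, J \subset D ->
  forall B : I -> set R, (forall i, measurable (B i)) ->
    P [set t | forall i, i \in J -> B i (X i t)] =
    (\prod_(i in J) P (X i @^-1` B i))%E.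

(* Only the weights of edges are constrained, and only they enter [sp_dist]. *)
Definition iid_exp1_weights (disp : measure_display)
    (T : measurableType disp) (R : realType) (P : probability T R)
    (V : finType) (e : rel V) (w : {set V} -> {RV P >-> R}) : Prop :=
  mutually_independent (edges e) w /\
  forall A : {set V}, A \in edges e ->
  forall B : set R, measurable B ->
    distribution P (w A) B = exponential_prob (1 : R) B.

(* Main.v *)
(** Ball growth: run the shortest-path exploration from v.  While the explored
    ball is U, each of its |delta(U)| boundary edges still has a memoryless
    Exp(1) residual weight, so the ball grows at rate |delta(U)|, which is at
    least alpha |U| n / 2 as long as 2|U| <= n.  Hence E[1/|B(v,t)|; 2|B| <= n]
    decays like exp(- alpha n t / 8).  The weights are rounded up to multiples
    of a small h, which makes the exploration a process on a finite probability
    space.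

    Nearest neighbor: the starting points of the steps longer than D, together
    with the last vertex of the tour, are pairwise at distance more than D, so
    their balls of radius D/2 are disjoint.  At most one of these balls contains
    more than n/2 vertices, and AM-GM bounds the number of the others by
    theta n / 2 + sum_v 1/(2 theta |B(v, D/2)|) over the small balls.  With
    theta decaying geometrically in D, summing over the scales D = 2hj gives
    E[NN] <= 64 / alpha.

    Ratio: if fewer than k, about n/4, edges are lighter than 1/(16 beta n),
    then half of the vertices touch no light edge and TSP >= 1/(32 beta).  A
    union bound over the k-sets of edges shows that this fails with probability
    at most 2^-k, and then NN <= 2n TSP always suffices. *)

Require Import Defs.
From HB Require Import structures.
From mathcomp Require Import all_boot all_order all_algebra.
From mathcomp Require Import all_classical all_reals all_analysis.
From mathcomp Require Import measurable_realfun.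
From mathcomp Require Import zify ring lra.

Set Implicit Arguments.
Unset Strict Implicit.
Unset Printing Implicit Defensive.
Import Order.TTheory GRing.Theory Num.Theory.
Import numFieldNormedType.Exports.
Local Open Scope classical_set_scope.
Local Open Scope ring_scope.

(** * Growth of balls *)

Section Growth.
Variables (V : finType) (e : rel V).
Hypothesis (e_sym : symmetric e) (e_irr : irreflexive e).

(** Weighted length of the walk, an edge [A] costing [k A] grid steps; not its number of edges. *)
Definition hops (k : {set V} -> nat) (x : V) (p : seq V) : nat :=
  sumn (pairmap (fun x y => k [set x; y]%SET) x p).

Definition ball (k : {set V} -> nat) (v : V) (j : nat) : {set V} :=
  [set y | `[< exists p, [/\ path e v p, last v p = y & (hops k v p <= j)%N] >]]%SET.

(** Confining the walk to [U] makes reachability a function of the weights inside [U] alone;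
    boundary weights do not enter. *)
Definition reach (U : {set V}) (k : {set V} -> nat) (v x : V) (c : nat) :=
  exists p, [/\ path e v p, last v p = x, all (mem U) p & (hops k v p <= c)%N].

Lemma hops_cat k x p q : hops k x (p ++ q) = (hops k x p + hops k (last x p) q)%N.
Proof. by rewrite /hops pairmap_cat sumn_cat. Qed.

Lemma ballP k v j y :
  reflect (exists p, [/\ path e v p, last v p = y & (hops k v p <= j)%N])
          (y \in ball k v j).
Proof. by rewrite inE; exact: asboolP. Qed.

Lemma mem_ball k v j : v \in ball k v j.
Proof. by apply/ballP; exists [::]. Qed.

Lemma ball_subS k v j : ball k v j \subset ball k v j.+1.
Proof. by apply/fintype.subsetP => y /ballP[p [? ? /leqW ?]]; apply/ballP; exists p. Qed.

Lemma mem_edges x y : e x y -> [set x; y]%SET \in edges e.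
Proof. by move=> exy; apply/imsetP; exists (x, y). Qed.

Lemma mem_edge_cut (U : {set V}) x y : e x y -> x \in U -> y \notin U ->
  [set x; y]%SET \in edge_cut e U.
Proof.
move=> exy xU yU; rewrite inE mem_edges //=; apply/cards1P; exists x.
apply/setP => z; rewrite !inE.
by have [->|zx] := eqVneq z x; [rewrite xU | have [->|//] := eqVneq z y; rewrite (negPf yU)].
Qed.

Lemma edge_cutP (U A : {set V}) : A \in edge_cut e U ->
  exists x y, [/\ e x y, x \in U, y \notin U & A = [set x; y]%SET].
Proof.
rewrite inE => /andP[/imsetP[[x y]]]; rewrite inE /= => exy ->{A} card1.
have xy : x != y by apply: contraTneq exy => ->; rewrite e_irr.

have [xU|xU] := boolP (x \in U); have [yU|yU] := boolP (y \in U).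
- move: card1; suff -> : ([set x; y] :&: U)%SET = [set x; y]%SET by rewrite cards2 xy.
  by apply/finset.setIidPl/fintype.subsetP => z /set2P[]->.
- by exists x, y.
- by exists y, x; split=> //; [rewrite e_sym | rewrite finset.setUC].
- move: card1; suff -> : ([set x; y] :&: U)%SET = finset.set0 by rewrite cards0.
  apply/setP => z; rewrite !inE; apply/negP => /andP[/orP[]/eqP->]; exact/negP.
Qed.

Lemma all_ball k v p j : path e v p -> (hops k v p <= j)%N ->
  all (mem (ball k v j)) p.
Proof.
move=> ep hp; apply/allP => z zp /=; apply/ballP.
case/splitPr: zp ep hp => p1 p2; rewrite -cat_rcons cat_path hops_cat => /andP[ep _] hp.
exists (rcons p1 z); split=> //; first by rewrite last_rcons.
exact: leq_trans (leq_addr _ _) hp.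
Qed.

(** Separates the event that the ball is [U] into a condition on inner weights and a lower bound on
    each boundary weight. For the converse, a walk of length at most [j] cannot take a first step
    out of [U], because the prefix before that step stays in [U]. *)
Lemma ball_eqP (U : {set V}) k v j : v \in U ->
  ball k v j = U <->
  (forall x, x \in U -> reach U k v x j) /\
  (forall x y, e x y -> x \in U -> y \notin U ->
     forall c, reach U k v x c -> (j < c + k [set x; y]%SET)%N).
Proof.
move=> vU; split=> [bU|[inU outU]].
  split=> [x|x y exy xU yU c [p [ep lp pU hp]]].
    rewrite -bU => /ballP[p [ep lp hp]]; exists p; split=> //.
    exact: all_ball.
  rewrite ltnNge; apply: contra yU => le_j; rewrite -bU; apply/ballP.
  exists (rcons p y); split; rewrite ?last_rcons ?rcons_path ?ep ?lp //.
  rewrite -cats1 hops_cat lp {2}/hops /= addn0.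
  by apply: leq_trans le_j; rewrite leq_add2r.
apply/setP => z; apply/idP/idP => [/ballP[p [ep <- hp]]|/inU[p [? ? _ ?]]]; last first.
  by apply/ballP; exists p.
suff pU : all (mem U) p by case/lastP: p pU {ep hp} => [//|p y]; rewrite last_rcons all_rcons => /andP[].
elim/last_ind: p ep hp => // p y IH.
rewrite rcons_path -cats1 hops_cat all_cat /= andbT => /andP[ep exy] hp.
have pU := IH ep (leq_trans (leq_addr _ _) hp); rewrite pU /=.
have lU : last v p \in U by case/lastP: p pU {IH ep exy hp} => [//|p ?]; rewrite last_rcons all_rcons => /andP[].
apply: contraLR hp => yU; rewrite -ltnNge {2}/hops /= addn0.
by apply: outU => //; exists p.
Qed.

Lemma eq_reach (U : {set V}) k k' v x c : v \in U ->
  (forall A, A \in edges e -> A \subset U -> k A = k' A) ->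
  reach U k v x c -> reach U k' v x c.
Proof.
move=> vU kk' [p [ep lp pU hp]]; exists p; split=> //.
suff <- : hops k v p = hops k' v p by [].
elim: p v vU ep pU {lp hp} => //= y p IH v vU /andP[evy ep] /andP[yU pU].
rewrite /hops /= -!/(hops _ _ _) (IH y) // kk' ?mem_edges //.
by apply/fintype.subsetP => z /set2P[]->.
Qed.

End Growth.

(** * Expected inverse size of a growing ball *)

Section Decay.
Variables (R : realFieldType) (V : finType) (e : rel V).
Hypothesis (e_sym : symmetric e) (e_irr : irreflexive e).
Variable N : nat.
Local Notation F := {ffun {set V} -> 'I_N.+2}.
(** [W] is the joint law of the discretised weights, [mu] their common marginal. [W_box] is
    independence over edges, [mu_tail] memorylessness with survival factor [q] per grid step. The
    top value N+1 stands for all weights beyond the grid. *)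
Variables (W : F -> R) (mu : pred 'I_N.+2 -> R).
Variable q : R.
Hypothesis W_ge0 : forall f, 0 <= W f.
Hypothesis W_box : forall (J : {set {set V}}) (Q : {set V} -> pred 'I_N.+2),
  J \subset edges e ->
  \sum_(f : F | [forall A in J, Q A (f A)]) W f = \prod_(A in J) mu (Q A).
Hypothesis mu_tail : forall c, (c < N)%N ->
  mu (fun m => (c.+1 < m)%N) = q * mu (fun m => (c < m)%N).

Local Notation gball f v j := (ball e (fun A => f A : nat) v j).

(* Condition on the weights of the edges inside U.  They determine the distances
   inside U, hence for each boundary edge a threshold which its weight must
   exceed; going from j to j+1 raises every threshold by one. *)
Lemma ball_stay v (U : {set V}) j : 0 <= q -> v \in U -> (j < N)%N ->
  \sum_(f : F | (gball f v j == U) && (gball f v j.+1 == U)) W f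
    <= q ^+ #|edge_cut e U| * \sum_(f : F | gball f v j == U) W f.
Proof.
move=> q_ge0 vU ltjN.
pose r (f : F) : F :=
  [ffun A => if (A \in edges e) && (A \subset U) then f A else ord0].
rewrite (partition_big r predT) //= [X in _ <= _ * X](partition_big r predT) //=.
rewrite mulr_sumr; apply: ler_sum => g _.
case: (pickP (fun f : F => ((gball f v j == U) && (gball f v j.+1 == U)) && (r f == g)));
  last first.
  move=> no_f; rewrite big_pred0; last by move=> f; rewrite no_f.
  by rewrite mulr_ge0 ?exprn_ge0 ?sumr_ge0.
move=> f0 /andP[/andP[/eqP f0U /eqP f0U'] /eqP rf0].
have [in0 _] := (ball_eqP e _ j vU).1 f0U.
have rE f : r f = g -> forall A, A \in edges e -> A \subset U -> f A = f0 A.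
  move=> rf A Ae AU; move/ffunP: rf => /(_ A); rewrite -rf0 !ffunE Ae AU /=; exact.
(* [m x] is the distance from [v] to [x] inside [U], the same on the whole fibre of [r]; the default
   0 does not occur for [x] in [U]. *)
pose m x := if pselect (exists c, `[< reach e U (fun A => f0 A : nat) v x c >]) is left h
            then ex_minn h else 0%N.
have mP x : x \in U -> [/\ reach e U (fun A => f0 A : nat) v x (m x), (m x <= j)%N &
    forall c, reach e U (fun A => f0 A : nat) v x c -> (m x <= c)%N].
  move=> xU; rewrite /m; case: pselect => [h|[]]; last by exists j; apply/asboolP; exact: in0.
  case: ex_minnP => c /asboolP rc cmin; split=> //.
    by apply: cmin; apply/asboolP; exact: in0.
  by move=> c' rc'; apply: cmin; apply/asboolP.
(* A boundary edge meets [U] in one vertex, so the [pick] is forced; at radius [j] the weight of the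
   edge must exceed [j - m x]. *)
pose thr (A : {set V}) : nat := (j - m (odflt v [pick x in A :&: U]%SET))%N.
have thrE x y : x \in U -> y \notin U -> thr [set x; y]%SET = (j - m x)%N.
  move=> xU yU; rewrite /thr; case: pickP => [z|/(_ x)]; last by rewrite !inE eqxx xU.
  by rewrite !inE => /andP[/orP[]/eqP-> //]; rewrite (negPf yU).
pose J := ([set A in edges e | A \subset U] :|: edge_cut e U)%SET.
(* Boxes with inner weights fixed and boundary weights above [thr + i]. One inclusion suffices at
   each end: the event of staying lies in the box for [i = 1], and the box for [i = 0] lies in the
   conditioning event. *)
pose Q i (A : {set V}) : pred 'I_N.+2 :=
  if A \in edge_cut e U then fun m : 'I_N.+2 => (thr A + i < m)%N else pred1 (f0 A).
have cutNsub A : A \in edge_cut e U -> (A \subset U) = false.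
  move=> /(edge_cutP e_sym e_irr)[x [y [_ _ yU ->]]].
  by apply/negP => /fintype.subsetP/(_ y); rewrite set22 => /(_ isT); apply/negP.
have Je : J \subset edges e.
  by apply/fintype.subsetP => A /setUP[]; rewrite inE => /andP[].
have box1 : \sum_(f : F | (gball f v j == U) && (gball f v j.+1 == U) && (r f == g)) W f
    <= \sum_(f : F | [forall A in J, Q 1%N A (f A)]) W f.
  rewrite [leRHS]big_mkcond /= big_mkcond /=; apply: ler_sum => f _.
  case: ifP => [|_]; last by case: ifP.
  move=> /andP[/andP[_ /eqP fU'] /eqP rf]; rewrite ifT //.
  apply/forall_inP => A; rewrite inE /Q; case: ifP => [Acut _|_].
    have [x [y [exy xU yU AE]]] := edge_cutP e_sym e_irr Acut.
    have [rx mj _] := mP x xU.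
    have rx' : reach e U (fun A => f A : nat) v x (m x).
      by apply: eq_reach rx => // B Be BU; rewrite (rE f).
    have := ((ball_eqP e _ j.+1 vU).1 fU').2 x y exy xU yU _ rx'.
    rewrite AE thrE //; lia.
  by rewrite orbF inE => /andP[Ae AU] /=; rewrite (rE f).
have box0 : \sum_(f : F | [forall A in J, Q 0%N A (f A)]) W f <=
    \sum_(f : F | (gball f v j == U) && (r f == g)) W f.
  rewrite [leRHS]big_mkcond /= big_mkcond /=; apply: ler_sum => f _.
  case: ifP => [/forall_inP fJ|_]; last by case: ifP.
  have fin A : A \in edges e -> A \subset U -> f A = f0 A.
    move=> Ae AU; have := fJ A; rewrite /J !inE Ae AU /= => /(_ isT).
    by rewrite /Q; case: ifP => [/cutNsub|_ /eqP//]; rewrite AU.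
  rewrite ifT //; apply/andP; split; last first.
    apply/eqP; rewrite -rf0; apply/ffunP => A; rewrite !ffunE.
    by case: ifP => // /andP[Ae AU]; rewrite fin.
  apply/eqP/ball_eqP => //; split=> [x xU|x y exy xU yU c rc].
    by apply: eq_reach (in0 x xU) => // B Be BU; rewrite fin.
  have Acut := mem_edge_cut exy xU yU.
  have xyJ : [set x; y]%SET \in J by rewrite finset.in_setU Acut orbT.
  have := fJ _ xyJ; rewrite /Q Acut thrE //.
  have [_ mj mmin] := mP x xU.
  have : (m x <= c)%N by apply: mmin; apply: eq_reach rc => // B Be BU; rewrite fin.
  lia.
apply: (le_trans box1); apply: (@le_trans _ _ (q ^+ #|edge_cut e U| *
    \sum_(f : F | [forall A in J, Q 0%N A (f A)]) W f)); last first.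
  by rewrite ler_wpM2l ?exprn_ge0.
rewrite !W_box //.
have -> : q ^+ #|edge_cut e U| = \prod_(A in J) (if A \in edge_cut e U then q else 1).
  rewrite -prodr_const [RHS]big_mkcond /= big_mkcond /=; apply: eq_bigr => A _.
  by rewrite finset.in_setU; case: (A \in edge_cut e U); rewrite ?orbT ?if_same.
rewrite -big_split /= le_eqVlt; apply/orP; left; apply/eqP; apply: eq_bigr => A _.
rewrite /Q; case: ifP => _; last by rewrite mul1r.
rewrite addn1 addn0 mu_tail //; apply: leq_ltn_trans ltjN; exact: leq_subr.
Qed.

(** Balls with more than half of the vertices count as zero: among disjoint balls at most one is
    that large, and it is handled separately. *)
Definition inv_small (b : nat) : R := if (2 * b <= #|V|)%N then b%:R^-1 else 0.

Lemma inv_small_ge0 b : 0 <= inv_small b.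
Proof. by rewrite /inv_small; case: ifP => // _; rewrite invr_ge0. Qed.

Lemma inv_small_anti b c : (0 < b)%N -> (b <= c)%N -> inv_small c <= inv_small b.
Proof.
move=> b0 bc; rewrite {1}/inv_small; case: ifP => [cV|_]; last exact: inv_small_ge0.
rewrite /inv_small ifT; last by lia.
by rewrite lef_pV2 ?posrE ?ltr0n ?ler_nat //; apply: leq_trans bc.
Qed.

Lemma W_total : \sum_f W f = 1.
Proof.
have := @W_box finset.set0 (fun _ => predT) (finset.sub0set _).
rewrite big_set0 => <-; apply: eq_bigl => f; apply/esym/forall_inP => A; by rewrite inE.
Qed.

(** Given that the ball is [U], it grows in the next step with probability at least
    [1 - q ^+ #|edge_cut e U|], and [inv_small] then drops at least to its value at [#|U|.+1]. The
    growth hypothesis makes the expected drop at least a fraction [x] of the current value. *)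
Lemma ball_decay v x j : 0 <= q -> 0 <= x <= 1 -> (j <= N)%N ->
  (forall U : {set V}, v \in U -> (2 * #|U| <= #|V|)%N ->
     x * inv_small #|U| <=
     (1 - q ^+ #|edge_cut e U|) * (inv_small #|U| - inv_small #|U|.+1)) ->
  \sum_(f : F) W f * inv_small #|gball f v j| <= (1 - x) ^+ j.
Proof.
(* [a] and [b] will be [inv_small] at [#|U|] and [#|U|.+1]; [s] and [t] the masses of being at [U]
   and of staying there. *)
have convex (a b s t p y : R) : (a - b) * t <= (a - b) * (p * s) ->
    y * a * s <= (1 - p) * (a - b) * s -> b * s + (a - b) * t <= (1 - y) * a * s.
  by lra.
move=> q_ge0 /andP[x0 x1] + growth; elim: j => [_|j IH ltjN].
  rewrite expr0 -W_total; apply: ler_sum => f _; apply: ler_piMr => //.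
  have b0 : (0 < #|gball f v 0|)%N by apply/card_gt0P; exists v; exact: mem_ball.
  rewrite /inv_small; case: ifP => // _.
  by rewrite invf_le1 ?ltr0n // ler1n.
apply: (@le_trans _ _ ((1 - x) * \sum_(f : F) W f * inv_small #|gball f v j|)); last first.
  by rewrite exprS ler_wpM2l ?subr_ge0 // IH // ltnW.
rewrite (partition_big (fun f : F => gball f v j) predT) //= mulr_sumr.
rewrite [leRHS](partition_big (fun f : F => gball f v j) predT) //=.
apply: ler_sum => U _.
have [vU|vU] := boolP (v \in U); last first.
  by rewrite !big_pred0 // => f; apply: contraNF vU => /eqP <-; exact: mem_ball.
have U0 : (0 < #|U|)%N by apply/card_gt0P; exists v.
set a := inv_small #|U|; set b := inv_small #|U|.+1.
have ba : b <= a by apply: inv_small_anti.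
have b0 : 0 <= b by exact: inv_small_ge0.
set S0 := \sum_(f : F | gball f v j == U) W f.
set S1 := \sum_(f : F | (gball f v j == U) && (gball f v j.+1 == U)) W f.
have S0_ge0 : 0 <= S0 by exact: sumr_ge0.
have -> : \sum_(f : F | gball f v j == U) (1 - x) * (W f * inv_small #|gball f v j|)
    = (1 - x) * a * S0.
  rewrite mulr_sumr; apply: eq_bigr => f /eqP ->; rewrite -/a; ring.
apply: (@le_trans _ _ (b * S0 + (a - b) * S1)).
  rewrite /S1 big_mkcondr /= !mulr_sumr -big_split /=; apply: ler_sum => f /eqP fU.
  case: eqP => [->|neq]; first by rewrite -/a; lra.
  rewrite mulr0 addr0 mulrC ler_wpM2r //; apply: inv_small_anti => //.
  apply: proper_card; rewrite finset.properEneq -{2}fU ball_subS andbT.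
  by rewrite eq_sym; apply/eqP.
have := ball_stay q_ge0 vU ltjN; rewrite -/S0 -/S1 => S10.
have gr : x * a <= (1 - q ^+ #|edge_cut e U|) * (a - b).
  have [Vs|Vl] := boolP (2 * #|U| <= #|V|)%N; first exact: growth.
  have -> : a = 0 by rewrite /a /inv_small (negPf Vl).
  have -> : b = 0 by rewrite /b /inv_small ifN //; lia.
  by rewrite subrr !mulr0.
apply: (convex _ _ _ _ (q ^+ #|edge_cut e U|)); first by rewrite ler_wpM2l ?subr_ge0.
by rewrite ler_wpM2r.
Qed.

End Decay.

(** * Shortest-path distances and tours *)

Section WalkCost.
Variables (R : realType) (V : finType) (f : V -> V -> R).

Lemma walk_cost_nil x : walk_cost f x [::] = 0.
Proof. by rewrite /walk_cost big_nil. Qed.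

Lemma walk_cost_cons x y p : walk_cost f x (y :: p) = f x y + walk_cost f y p.
Proof. by rewrite /walk_cost /= big_cons. Qed.

Lemma walk_cost_cat x p q :
  walk_cost f x (p ++ q) = walk_cost f x p + walk_cost f (last x p) q.
Proof. by rewrite /walk_cost pairmap_cat big_cat. Qed.

Lemma walk_cost_rcons x p y :
  walk_cost f x (rcons p y) = walk_cost f x p + f (last x p) y.
Proof. by rewrite -cats1 walk_cost_cat walk_cost_cons walk_cost_nil addr0. Qed.

Lemma walk_cost_ge0 (e : rel V) x p : (forall a b, e a b -> 0 <= f a b) ->
  path e x p -> 0 <= walk_cost f x p.
Proof.
move=> f0; elim: p x => [|y p IH] x /=; first by rewrite walk_cost_nil.
by move=> /andP[exy ep]; rewrite walk_cost_cons addr_ge0 ?f0 ?IH.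
Qed.

End WalkCost.

Section ShortestPath.
Variables (R : realType) (V : finType) (e : rel V) (w : {set V} -> R).
Hypothesis e_sym : symmetric e.
Hypothesis e_conn : forall u v, connect e u v.
Hypothesis w_ge0 : forall A, A \in edges e -> 0 <= w A.

Local Notation wf := (fun x y => w [set x; y]%SET).
Local Notation d := (sp_dist e w).

Lemma edge_weight_ge0 x y : e x y -> 0 <= wf x y.
Proof. by move=> exy; apply: w_ge0; exact: mem_edges. Qed.

(** Loop erasure: a closed walk cut out has nonnegative cost. Thus [sp_dist], an infimum over simple
    paths, is also bounded by arbitrary walks. *)
Lemma simple_path_le u p : path e u p -> exists p',
  [/\ path e u p', last u p' = last u p, uniq (u :: p') &
      walk_cost wf u p' <= walk_cost wf u p].
Proof.
elim: p u => [|y p IH] u /=; first by exists [::].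
move=> /andP[euy /IH[p' [ep lp up cp]]].
have [uy|uy] := boolP (u \in y :: p'); last first.
  by exists (y :: p'); split; rewrite /= ?euy // ?uy // !walk_cost_cons lerD2l.
have eyp : path e u (y :: p') by rewrite /= euy.
case/splitPr E : _ / uy => [p1 p2].
move: eyp; rewrite E cat_path /= => /and3P[ep1 _ ep2].
exists p2; split=> //.
- by rewrite -lp -[last y p']/(last u (y :: p')) E last_cat.
- by move: up; rewrite E cat_uniq => /and3P[_ _].
- apply: (@le_trans _ _ (walk_cost wf u (y :: p'))); last by rewrite !walk_cost_cons lerD2l.
  rewrite E walk_cost_cat walk_cost_cons addrA lerDr.
  apply: addr_ge0; first exact: walk_cost_ge0 edge_weight_ge0 ep1.
  have : path e u (y :: p') by rewrite /= euy.
  by rewrite E cat_path /= => /and3P[_ ? _]; exact: edge_weight_ge0.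
Qed.

Lemma sp_dist_le u p : path e u p -> d u (last u p) <= walk_cost wf u p.
Proof.
move=> /simple_path_le[p' [ep lp up cp]]; apply: le_trans cp.
apply: ge_inf; last by exists p'.
exists 0 => _ [p0 [ep0 _ _] <-]; exact: walk_cost_ge0 edge_weight_ge0 ep0.
Qed.

(** Connectedness makes the set of paths nonempty, so [inf] is a genuine greatest lower bound. *)
Lemma sp_dist_ge u v c :
  (forall p, path e u p -> last u p = v -> uniq (u :: p) -> c <= walk_cost wf u p) ->
  c <= d u v.
Proof.
move=> cP; apply: lb_le_inf; last by move=> _ [p [? ? ?] <-]; exact: cP.
have /connectP[p /simple_path_le[p' [ep lp up _]] vE] := e_conn u v.
by exists (walk_cost wf u p'), p'; split; rewrite // lp vE.
Qed.

Lemma sp_dist_ge0 u v : 0 <= d u v.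
Proof. by apply: sp_dist_ge => p ep _ _; exact: walk_cost_ge0 edge_weight_ge0 ep. Qed.

Lemma sp_dist_refl u : d u u = 0.
Proof.
apply: le_anti; rewrite sp_dist_ge0 andbT.
by have := @sp_dist_le u [::] isT; rewrite walk_cost_nil.
Qed.

Lemma sp_dist_triangle u v z : d u z <= d u v + d v z.
Proof.
rewrite -lerBlDr; apply: sp_dist_ge => p ep lp _.
rewrite lerBlDl -lerBlDr; apply: sp_dist_ge => q eq' lq _; rewrite lerBlDl.
have := @sp_dist_le u (p ++ q).
by rewrite cat_path ep lp last_cat lp lq walk_cost_cat lp; exact.
Qed.

Lemma rev_walk u p : path e u p -> exists p',
  [/\ path e (last u p) p', last (last u p) p' = u &
      walk_cost wf (last u p) p' = walk_cost wf u p].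
Proof.
elim: p u => [|y p IH] u /=; first by exists [::].
move=> /andP[euy /IH[p' [ep lp cp]]]; exists (rcons p' u).
rewrite rcons_path last_rcons ep lp e_sym euy walk_cost_rcons lp cp walk_cost_cons.
by split=> //; rewrite addrC finset.setUC.
Qed.

Lemma sp_dist_sym u v : d u v = d v u.
Proof.
wlog suff : u v / d u v <= d v u by move=> le; apply: le_anti; rewrite !le.
apply: sp_dist_ge => p /rev_walk[p' [ep lp <-]] lpu _; rewrite lpu in ep lp *.
by rewrite -{1}lp; exact: sp_dist_le.
Qed.

Lemma sp_dist_ge_nearest u v c : u != v ->
  (forall A, A \in edges e -> u \in A -> c <= w A) -> c <= d u v.
Proof.
move=> uv cw; apply: sp_dist_ge => -[|y p] /=; first by move=> _ /eqP; rewrite (negPf uv).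
move=> /andP[euy ep] _ _; rewrite walk_cost_cons.
apply: ler_wpDr; first exact: walk_cost_ge0 edge_weight_ge0 ep.
by apply: cw; [exact: mem_edges | rewrite set21].
Qed.

(** Rounding weights up only lengthens paths, so a discretised ball lies in the metric ball of
    radius [h * j]. The comparison is asked only for [k A <= j], since the top truncated level gives
    no upper bound on a weight. *)
Lemma sp_dist_ball (k : {set V} -> nat) h j v y :
  (forall A, A \in edges e -> (k A <= j)%N -> w A <= h * (k A)%:R) -> 0 <= h ->
  y \in ball e k v j -> d v y <= h * j%:R.
Proof.
move=> wk h0 /ballP[p [ep <- hp]]; apply: (le_trans (sp_dist_le ep)).
apply: (@le_trans _ _ (h * (hops k v p)%:R)); last by rewrite ler_wpM2l // ler_nat.
elim: p v ep hp => [|z p IH] v /=; first by rewrite walk_cost_nil mulr0.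
move=> /andP[evz ep]; rewrite /hops /= -/(hops k z p) => hp.
rewrite walk_cost_cons natrD mulrDr lerD ?IH //; last exact: leq_trans (leq_addl _ _) hp.
by apply: wk; [exact: mem_edges | exact: leq_trans (leq_addr _ _) hp].
Qed.

End ShortestPath.

(** * Tours in a finite pseudometric *)

Section Tours.
Variables (R : realType) (V : finType) (d : V -> V -> R).
Hypothesis d_ge0 : forall x y, 0 <= d x y.
Hypothesis d_refl : forall x, d x x = 0.
Hypothesis d_sym : forall x y, d x y = d y x.
Hypothesis d_triangle : forall x y z, d x z <= d x y + d y z.

Lemma walk_cost_dist_ge0 x p : 0 <= walk_cost d x p.
Proof. by elim: p x => [|y p IH] x; rewrite ?walk_cost_nil // walk_cost_cons addr_ge0. Qed.

Lemma walk_cost_ge_dist x p y : y \in x :: p -> d x y <= walk_cost d x p.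
Proof.
elim: p x => [|z p IH] x /predU1P[->|//]; rewrite ?d_refl ?walk_cost_dist_ge0 //.
move=> yp; rewrite walk_cost_cons; apply: (le_trans (d_triangle x z y)).
by rewrite lerD2l IH.
Qed.

Lemma tour_length_le2 x p : tour_length d (x :: p) <= 2 * walk_cost d x p.
Proof.
rewrite /= walk_cost_rcons d_sym.
have := walk_cost_ge_dist (mem_last x p); lra.
Qed.

Lemma dist_le_tour s a b : is_tour s -> d a b <= 2 * tour_length d s.
Proof.
case: s => [|x p] /perm_mem st; first by have := st a; rewrite mem_enum.
have walkD y : d x y <= walk_cost d x p by apply: walk_cost_ge_dist; rewrite st mem_enum.
have walkT : walk_cost d x p <= tour_length d (x :: p) by rewrite /= walk_cost_rcons lerDl.
have := d_triangle a x b; rewrite (d_sym a x).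
have := walkD a; have := walkD b; lra.
Qed.

Lemma tour_nonempty : is_tour (enum V).
Proof. exact: perm_refl. Qed.

(** Crude bound for the rare outcomes with many light edges: each of the [#|V|] steps is a distance,
    hence at most twice the length of any tour. *)
Lemma tour_length_le_tsp s : is_tour s ->
  tour_length d s <= 2 * #|V|%:R * tsp_length d.
Proof.
move=> ts; have sz : size s = #|V| by rewrite (perm_size ts) -cardE.
have [V0|V0] := posnP #|V|.
  rewrite V0 in sz *; rewrite (size0nil sz) /= mulr0 mul0r //.
have n0 : 0 < 2 * #|V|%:R :> R by rewrite mulr_gt0 // ltr0n.
rewrite mulrC -ler_pdivrMr //; apply: lb_le_inf.
  by exists (tour_length d (enum V)), (enum V); first exact: tour_nonempty.
move=> _ [s' ts' <-]; rewrite ler_pdivrMr //.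
have dT := dist_le_tour _ _ ts'.
have walkT x p : walk_cost d x p <= (size p)%:R * (2 * tour_length d s').
  elim: p x => [|y p IH] x; first by rewrite walk_cost_nil mul0r.
  rewrite walk_cost_cons /= -natr1 mulrDl mul1r addrC lerD //; exact: dT.
case: s {ts} sz => [|x p] /= sz; first by rewrite -sz in V0.
by have := walkT x (rcons p x); rewrite size_rcons sz; lra.
Qed.

Lemma tsp_length_ge0 : 0 <= tsp_length d.
Proof.
apply: lb_le_inf; first by exists (tour_length d (enum V)), (enum V); first exact: tour_nonempty.
move=> _ [[|x p] _ <-] //=; exact: walk_cost_dist_ge0.
Qed.

(** A tour leaves every vertex exactly once, towards a different vertex, so each [m v] is charged
    once. *)
Lemma tsp_length_ge_nearest (m : V -> R) : (1 < #|V|)%N ->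
  (forall x y, x != y -> m x <= d x y) -> \sum_v m v <= tsp_length d.
Proof.
move=> V1 md; apply: lb_le_inf.
  by exists (tour_length d (enum V)), (enum V); first exact: tour_nonempty.
move=> _ [s ts <-].
have -> : \sum_v m v = \sum_(v <- s) m v by rewrite (perm_big _ ts) big_enum.
have us : uniq s by rewrite (perm_uniq ts) enum_uniq.
have sz : size s = #|V| by rewrite (perm_size ts) -cardE.
case: s us sz {ts} => [|x p] us sz; first by rewrite -sz in V1.
have walk_ge q a : path (fun a b => a != b) a q ->
    \sum_(z <- belast a q) m z <= walk_cost d a q.
  elim: q a => [|b q IH] a /=; first by rewrite big_nil walk_cost_nil.
  by move=> /andP[ab /IH]; rewrite big_cons walk_cost_cons; apply: lerD; exact: md.
rewrite [leRHS]/= -{1}(belast_rcons x p x); apply: walk_ge.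
rewrite rcons_path; apply/andP; split.
  by move: us; rewrite uniq_pairwise => /pairwise_sorted.
case: p us sz => [|y p] /= us sz; first by rewrite -sz in V1.
by apply: contraTneq us => <-; rewrite mem_last.
Qed.

(* Includes the last vertex of the walk, whether or not it starts a long step:
   being at distance more than D from all the others, it pays for the at most
   one large ball in [long_steps_le]. *)
Fixpoint long_starts (D : R) (x : V) (p : seq V) : seq V :=
  if p is y :: q then
    if D < d x y then x :: long_starts D y q else long_starts D y q
  else [:: x].

Lemma long_starts_size D x p :
  size (long_starts D x p) = (count (fun c => D < c) (pairmap d x p)).+1.
Proof. by elim: p x => //= y p IH x; case: ifP => _ /=; rewrite IH. Qed.

Lemma long_starts_subseq D x p : subseq (long_starts D x p) (x :: p).
Proof.
elim: p x => [|y p IH] x; first by rewrite /= eqxx.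
rewrite [long_starts _ _ _]/=; case: ifP => _ ; first exact: (@cat_subseq _ [:: x] _ [:: x] _ (subseq_refl _) (IH y)).
exact: subseq_trans (IH y) (subseq_cons _ _).
Qed.

(** A long step from [a] goes to a nearest unvisited vertex, so every vertex visited later is
    farther than [D] from [a]. *)
Lemma long_starts_separated D x p :
  (forall p1 a y q, x :: p = p1 ++ a :: y :: q ->
     forall z, z \in y :: q -> d a y <= d a z) ->
  pairwise (fun a b => D < d a b) (long_starts D x p).
Proof.
elim: p x => [//|y p IH] x nn /=.
have {}IH : pairwise (fun a b => D < d a b) (long_starts D y p).
  by apply: IH => p1 a b q E; apply: (nn (x :: p1)); rewrite E.
case: ifP => // xy /=; rewrite IH andbT; apply/allP => z.
move=> /(mem_subseq (long_starts_subseq _ _ _)) zp.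
exact: lt_le_trans xy (nn [::] x y p erefl z zp).
Qed.

(** Packing of disjoint balls around the long starts; [th] is the free AM-GM parameter, to be tuned
    to the scale [D]. *)
Lemma long_steps_le D x p (b : V -> {set V}) (th : R) : 0 < th ->
  is_nn_tour d (x :: p) ->
  (forall v, v \in b v) -> (forall v y, y \in b v -> d v y <= D / 2) ->
  (count (fun c => D < c) (pairmap d x p))%:R
    <= th / 2 * #|V|%:R + (2 * th)^-1 * \sum_v inv_small R V #|b v|.
Proof.
move=> th0 [tour nn] bv bD; set cnt := count _ _.
have sep := long_starts_separated D nn.
have us : uniq (x :: p) by rewrite (perm_uniq tour) enum_uniq.
have uL : uniq (long_starts D x p) := subseq_uniq (long_starts_subseq D x p) us.
have sepP u v : u \in long_starts D x p -> v \in long_starts D x p -> u != v -> D < d u v.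
  elim: (long_starts D x p) sep => //= a L IH /andP[/allP aL /IH{}IH].
  rewrite !inE => /orP[/eqP->|uL'] /orP[/eqP->|vL'] uv.
  - by rewrite eqxx in uv.
  - exact: aL.
  - by rewrite d_sym; exact: aL.
  - exact: IH.
pose L := [set v in long_starts D x p]%SET.
have cL : #|L| = cnt.+1.
  by rewrite cardsE (card_uniqP uL) long_starts_size.
(* By the triangle inequality no [y] lies in two of the balls; counting by [y] bounds their total
   size. *)
have disj : (\sum_(v in L) #|b v| <= #|V|)%N.
  rewrite (eq_bigr (fun v => \sum_(y : V | y \in b v) 1)%N); last by move=> v _; rewrite sum1_card.
  rewrite (exchange_big_dep predT) //= -sum1_card; apply: leq_sum => y _.
  rewrite sum1_card; apply/card_le1P => u /andP[uL' yu] v.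
  rewrite -[LHS]/((v \in L) && (y \in b v)) -[RHS]/(v == u).
  apply/andP/idP => [[vL yv]|/eqP->]; last by split.
  apply: contraT => vu; move: uL' vL; rewrite !inE => uL' vL.
  have := sepP v u vL uL' vu; have := d_triangle v y u; rewrite (d_sym y u).
  have := bD v y yv; have := bD u y yu; lra.
pose big := [set v in L | (#|V| < 2 * #|b v|)%N]%SET.
pose small := [set v in L | (2 * #|b v| <= #|V|)%N]%SET.
have cbig : (#|big| <= 1)%N.
  have : (\sum_(v in big) #|V|.+1 <= 2 * #|V|)%N.
    apply: leq_trans (_ : 2 * (\sum_(v in L) #|b v|) <= _)%N; last by rewrite leq_mul2l.
    rewrite big_distrr /= [leqRHS](bigID (fun v => #|V| < 2 * #|b v|)%N) /=.
    apply: leq_trans (leq_addr _ _).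
    rewrite [leqRHS](eq_bigl (mem big)); last by move=> v; rewrite !inE.
    by apply: leq_sum => v; rewrite !inE => /andP[].
  rewrite sum_nat_const; nia.
have csmall : (cnt <= #|small|)%N.
  have : (#|L| <= #|small :|: big|)%N.
    apply: subset_leq_card; apply/fintype.subsetP => v vL.
    by rewrite !inE in vL *; rewrite vL /=; case: leqP.
  have := cardsUI small big; lia.
apply: (@le_trans _ _ (#|small|%:R)); first by rewrite ler_nat.
apply: (@le_trans _ _ (\sum_(v in small) (th / 2 * #|b v|%:R + (2 * th)^-1 * inv_small R V #|b v|))).
  rewrite -sumr_const; apply: ler_sum => v; rewrite inE => /andP[_ vs].
  rewrite /inv_small vs.
  have bv0 : 0 < #|b v|%:R :> R by rewrite ltr0n; apply/card_gt0P; exists v.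
  (* AM-GM *)
  have -> : th / 2 * #|b v|%:R + (2 * th)^-1 * #|b v|%:R^-1
     = 1 + (th * #|b v|%:R - 1) ^+ 2 / (2 * th * #|b v|%:R).
    by field; rewrite !gt_eqF.
  by rewrite lerDl divr_ge0 ?sqr_ge0 // !mulr_ge0 // ltW.
rewrite big_split /= -!mulr_sumr lerD //.
  apply: ler_wpM2l; first by rewrite divr_ge0 ?ltW.
  rewrite -natr_sum ler_nat; apply: leq_trans disj.
  by rewrite [leqRHS](bigID (mem small)) /= (eq_bigl (fun v => (v \in L) && (v \in small)))
    ?leq_addr // => v; rewrite !inE andbA andbb.
apply: ler_wpM2l; first by rewrite invr_ge0 mulr_ge0 ?ltW.
rewrite [leRHS](bigID (mem small)) /= lerDl sumr_ge0 // => v _; exact: inv_small_ge0.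
Qed.

(** Layer-cake sum with layers of height [D]: each [c] is at most [D] times the number of grid
    points [D * j] strictly below it. *)
Lemma sum_le_layers (D : R) (J : nat) (s : seq R) : 0 < D ->
  (forall c, c \in s -> 0 <= c <= D * J%:R) ->
  \sum_(c <- s) c <= \sum_(j < J) D * (count (fun c => (D * j%:R < c)%R) s)%:R.
Proof.
move=> D0 sJ.
have layer c : 0 <= c <= D * J%:R -> c <= \sum_(j < J) D * (D * j%:R < c)%R%:R.
  elim: J {sJ} => [|J IH] /andP[c0 cJ]; first by rewrite big_ord0; lra.
  have [le_c|lt_c] := leP c (D * J%:R).
    rewrite big_ord_recr /= ltNge le_c mulr0 addr0; apply: IH; exact/andP.
  apply: (le_trans cJ); rewrite (eq_bigr (fun=> D)); last first.
    move=> i _; suff -> : D * i%:R < c by rewrite mulr1.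
    by apply: le_lt_trans lt_c; rewrite ler_pM2l // ler_nat -ltnS.
  by rewrite sumr_const card_ord mulr_natr.
apply: (@le_trans _ _ (\sum_(c <- s) \sum_(j < J) D * (D * j%:R < c)%R%:R)).
  by rewrite big_seq [leRHS]big_seq; apply: ler_sum => c cs; apply: layer; exact: sJ.
rewrite exchange_big /=; apply: ler_sum => j _; rewrite -mulr_sumr.
apply: ler_wpM2l; first exact: ltW.
rewrite -sum1_count natr_sum [leRHS]big_mkcond /=; apply: ler_sum => c _.
by case: (D * j%:R < c).
Qed.

End Tours.

(** * Discretised exponential weights *)

Section Probability.
Variables (disp : measure_display) (T : measurableType disp) (R : realType).
Variable P : probability T R.

(** Made for an [f] that may fail to be measurable: the integral of its positive part is a supremum
    over simple functions below it, so domination by [g] passes to integrals, and dropping the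
    negative part only increases the value. *)
Lemma expectation_le_ae (N : set T) (f : T -> R) (g : T -> \bar R) :
  measurable N -> P N = 0%E -> measurable_fun setT g ->
  (forall t, (0 <= g t)%E) -> (forall t, ~ N t -> ((f t)%:E <= g t)%E) ->
  ('E_P[f] <= \int[P]_t g t)%E.
Proof.
move=> mN PN mg g0 fg; rewrite unlock.
(* Adding [+oo] on the null set makes the domination hold everywhere without changing the
   integral. *)
pose g' t := (g t + (cst +oo%E \_ N) t)%E.
have g'N t : ~ N t -> g' t = g t by move=> Nt; rewrite /g' patchE memNset // adde0.
have g'0 t : (0 <= g' t)%E by rewrite /g' adde_ge0 // patchE; case: ifP => // _; rewrite leey.
have mg' : measurable_fun setT g'.
  by apply: emeasurable_funD => //; apply/(measurable_restrictT _ mN); exact: measurable_cst.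
have -> : (\int[P]_t g t = \int[P]_t g' t)%E.
  apply: ge0_ae_eq_integral => //; exists N; split=> // t /=.
  by apply: contra_notP => Nt _; rewrite g'N.
rewrite integralE; apply: (@le_trans _ _ (\int[P]_x (EFin \o f)^\+ x)%E).
  by rewrite -[leRHS]sube0; apply: leeB => //; exact: integral_ge0.
rewrite !ge0_integralTE //; apply: ereal_sup_le => _ [h hf <-].
exists h => // t; apply: (le_trans (hf t)).
rewrite funeposE ge_max g'0 andbT /=.
have [Nt|Nt] := pselect (N t); last by rewrite g'N // fg.
by rewrite /g' patchE mem_set //= addey ?leey // gt_eqF // (lt_le_trans _ (g0 t)) ?ltNy0.
Qed.

Lemma prob_finite_partition (F : finType) (K : T -> F) (Q : pred F) :
  (forall f, measurable (K @^-1` [set f])) ->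
  P [set t | Q (K t)] = (\sum_(f | Q f) P (K @^-1` [set f]))%E.
Proof.
move=> mK.
have -> : [set t | Q (K t)] = \bigcup_(f in [set` enum Q]) (K @^-1` [set f]).
  apply/seteqP; split=> [t /= Qt|t /= [f /= Qf fE]]; last by move: Qf; rewrite -fE mem_enum.
  by exists (K t) => //=; rewrite mem_enum.
rewrite measure_fin_bigcup ?finite_finset //; first by rewrite -fsbig_seq ?enum_uniq // big_enum.
by move=> f g _ _ [t [/= <- <-]].
Qed.

End Probability.

Section Exponential.
Variable R : realType.

Lemma exponential_prob_lt0 : exponential_prob (1 : R) `]-oo, 0[ = 0%E.
Proof.
rewrite /exponential_prob; apply: integral0_eq => x; rewrite /= in_itv /= => x0.
by rewrite lt0_exponential_pdf.
Qed.

Lemma exponential_prob_le (c : R) : 0 <= c ->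
  exponential_prob (1 : R) `]-oo, c] = (1 - (expR (- c))%:E)%E.
Proof.
move=> c0; have c0' : (BLeft 0 <= BRight c :> itv_bound R)%O by rewrite bnd_simp.
have -> : `]-oo, c]%classic = `]-oo, 0[%classic `|` `[0, c]%classic :> set R.
  by rewrite -itv_bndbnd_setU.
rewrite (measureU (exponential_prob (1 : R))) //=; last first.
  apply/seteqP; split=> // x [] /=; rewrite !in_itv /= => x0 /andP[x1 _].
  by move: (lt_le_trans x0 x1); rewrite ltxx.
rewrite [X in (X + _)%E]exponential_prob_lt0 add0e.
have [->|cn0] := eqVneq c 0.
  by rewrite oppr0 expR0 subee // set_itv1 /exponential_prob integral_set1.
have := @exponential_prob_itv0c R 1 c; rewrite mulN1r; apply.
by rewrite lt_neqAle eq_sym cn0.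
Qed.

Lemma exponential_prob_gt (c : R) : 0 <= c ->
  exponential_prob (1 : R) `]c, +oo[ = (expR (- c))%:E.
Proof.
move=> c0; have -> : `]c, +oo[%classic = ~` `]-oo, c]%classic :> set R by rewrite setCitvl.
have := @probability_setC _ _ _ (exponential_prob (1 : R)) `]-oo, c].
move=> ->; last exact: measurable_itv.
by rewrite [X in (_ - X)%E](exponential_prob_le c0) -!EFinB subKr.
Qed.

Lemma exponential_prob_lt (c : R) : 0 <= c ->
  (exponential_prob (1 : R) `]-oo, c[ <= c%:E)%E.
Proof.
move=> c0; apply: (@le_trans _ _ (exponential_prob (1 : R) `]-oo, c])).
  apply: (le_measure (exponential_prob (1 : R))); rewrite ?inE ?ltr01 //; do ?exact: measurable_itv.
  by move=> x /=; rewrite !in_itv /=; exact: ltW.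
rewrite exponential_prob_le // -EFinB lee_fin.
have := expR_ge1Dx (- c); lra.
Qed.

Variables (N : nat) (h : R).
Hypothesis h_ge0 : 0 <= h.

(* Discretised weight: the number of grid points [h * i], [i <= N], below [x]. *)
Definition level (x : R) : 'I_N.+2 :=
  inord (find (fun i => x <= h * i%:R) (iota 0 N.+1)).

Lemma level_gt c x : (c <= N)%N -> (c < level x)%N = (h * c%:R < x).
Proof.
move=> cN; rewrite inordK; last first.
  by rewrite ltnS (leq_trans (find_size _ _)) // size_iota.
apply/idP/idP => [/(before_find 0)|].
  by rewrite nth_iota // add0n leNgt => /negbFE.
apply: contraTT; rewrite -leqNgt -leNgt => fc.
have fS : (find (fun i => (x <= h * i%:R)%R) (iota 0 N.+1) < N.+1)%N by exact: leq_ltn_trans fc _.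
have := @nth_find _ 0 (fun i => (x <= h * i%:R)%R) (iota 0 N.+1).
rewrite has_find size_iota fS => /(_ isT); rewrite nth_iota // add0n => le_x.
by apply: (le_trans le_x); rewrite ler_wpM2l // ler_nat.
Qed.

Lemma level_le x j : (j <= N)%N -> (level x <= j)%N -> x <= h * (level x)%:R.
Proof.
by move=> jN xj; rewrite leNgt -level_gt ?ltnn // (leq_trans xj).
Qed.

Lemma measurable_level (Q : pred 'I_N.+2) : measurable [set x | Q (level x)].
Proof.
have gtm c : measurable [set x | (c < level x)%N].
  have [cN|Nc] := leqP c N.
    rewrite (_ : mkset _ = `]h * c%:R, +oo[%classic); first exact: measurable_itv.
    by apply/seteqP; split=> x /=; rewrite in_itv /= andbT level_gt.
  rewrite (_ : mkset _ = set0) //; apply/seteqP; split=> // x /=.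
  have := ltn_ord (level x); lia.
have eqm (m : 'I_N.+2) : measurable [set x | level x = m].
  rewrite (_ : mkset _ = ~` [set x | (m < level x)%N] `&`
                        (if (m : nat) is c.+1 then [set x | (c < level x)%N] else setT) :> set R).
    by apply: measurableI; [exact: measurableC | case: (m : nat)].
  apply/seteqP; split=> x /=.
    by move=> <-; rewrite ltnn; split=> //; case E : (level x : nat) => [|c] //=; rewrite E.
  move=> [/negP]; rewrite -leqNgt => xm; case E : (m : nat) xm => [|c] xm /= cx; apply: val_inj => /=; lia.
rewrite (_ : mkset _ = \bigcup_(m in [set` Q]) [set x | level x = m]).
  by apply: fin_bigcup_measurable => [|m _]; [exact: finite_finset | exact: eqm].
by apply/seteqP; split=> [x /= Qx|x [m /= Qm xm]]; [exists (level x) | rewrite xm].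
Qed.

End Exponential.

(** * Cut parameters *)

Lemma vertex_cut (V : finType) (v : V) : (1 < #|V|)%N ->
  [set v]%SET != finset.set0 /\ [set v]%SET \proper finset.setT.
Proof.
move=> V_gt1; split; first by apply/set0Pn; exists v; rewrite inE.
by rewrite properEcard finset.subsetT cardsT cards1.
Qed.

Section CutParameters.
Variables (R : realType) (V : finType) (e : rel V).
Hypothesis V_gt1 : (1 < #|V|)%N.
Hypothesis G_conn : simple_connected_graph e.

Let e_sym : symmetric e. Proof. by case: G_conn. Qed.
Let e_irr : irreflexive e. Proof. by case: G_conn. Qed.

(** An empty cut would make [U] closed under adjacency, against connectedness. *)
Lemma edge_cut_gt0 (U : {set V}) : U != finset.set0 -> U \proper finset.setT ->
  (0 < #|edge_cut e U|)%N.
Proof.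
case: G_conn => _ _ conn /set0Pn[u uU] /properP[_ [z _ zU]].
rewrite lt0n; apply: contra zU; rewrite cards_eq0 => /eqP cut0.
have clU : fingraph.closed e (mem U).
  apply: (intro_closed (sym_connect_sym e_sym)) => x y exy xU; apply: contraT => yU.
  by have := mem_edge_cut exy xU yU; rewrite cut0 inE.
by rewrite -[z \in U]/(z \in mem U) -(closed_connect clU (conn u z)).
Qed.

Let vol_gt0 (U : {set V}) : U != finset.set0 -> U \proper finset.setT ->
  (0 < #|U| * (#|V| - #|U|))%N.
Proof.
rewrite -card_gt0 => U0 /proper_card; rewrite cardsT => UV.
by rewrite muln_gt0 U0 subn_gt0.
Qed.

Lemma cut_ratio_ge0 (U : {set V}) : 0 <= cut_ratio R e U.
Proof. by rewrite divr_ge0. Qed.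

Lemma alpha_le (U : {set V}) : U != finset.set0 -> U \proper finset.setT ->
  alpha R e * (#|U| * (#|V| - #|U|))%N%:R <= #|edge_cut e U|%:R.
Proof.
move=> U0 UT; rewrite -ler_pdivlMr ?ltr0n ?vol_gt0 //.
apply: ge_inf; last by exists U.
by exists 0 => _ [U' _ <-]; exact: cut_ratio_ge0.
Qed.

(** Every cut has an edge and every denominator is at most the square of [#|V|]: a uniform lower
    bound on the ratios. *)
Lemma alpha_gt0 : 0 < alpha R e.
Proof.
have n0 : 0 < (#|V| * #|V|)%:R^-1 :> R by rewrite invr_gt0 ltr0n muln_gt0 andbb ltnW.
apply: (lt_le_trans n0); apply: lb_le_inf.
  have /card_gt0P[v _] := ltnW V_gt1; exists (cut_ratio R e [set v]%SET), [set v]%SET => //.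
  exact: (vertex_cut v V_gt1).
move=> _ [U [U0 UT] <-]; rewrite /cut_ratio -[leLHS]mul1r; apply: ler_pM => //.
- by rewrite ler1n edge_cut_gt0.
- rewrite lef_pV2 ?posrE ?ltr0n ?vol_gt0 ?muln_gt0 ?ler_nat ?(ltnW V_gt1) //.
  by apply: leq_mul; [exact: max_card | exact: leq_subr].
Qed.

Lemma cut_ratio_le_beta (U : {set V}) : U != finset.set0 -> U \proper finset.setT ->
  cut_ratio R e U <= beta R e.
Proof.
move=> U0 UT; apply: ub_le_sup; last by exists U.
exists (\sum_(U' : {set V}) cut_ratio R e U') => _ [U' _ <-].
by rewrite (bigD1 U') //= lerDl sumr_ge0 // => *; exact: cut_ratio_ge0.
Qed.

Lemma alpha_le_beta : alpha R e <= beta R e.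
Proof.
have /card_gt0P[v _] := ltnW V_gt1; have [v0 vT] := vertex_cut v V_gt1.
apply: le_trans (cut_ratio_le_beta v0 vT).
by rewrite ler_pdivlMr ?ltr0n ?vol_gt0 // alpha_le.
Qed.

Lemma card_edge_cut_le (U : {set V}) : (#|edge_cut e U| <= #|edges e|)%N.
Proof. by apply: subset_leq_card; apply/fintype.subsetP => A; rewrite inE => /andP[]. Qed.

(** Tested on a single vertex, whose degree is at most the number of edges; the 2 absorbs passing
    from [#|V| - 1] to [#|V|]. For [h * #|edges e| <= 1] it gives h alpha n <= 2. *)
Lemma alpha_mul_card_le : alpha R e * #|V|%:R <= 2 * #|edges e|%:R.
Proof.
have /card_gt0P[v _] := ltnW V_gt1; have [v0 vT] := vertex_cut v V_gt1.
have := alpha_le v0 vT; rewrite cards1 mul1n => av.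
apply: (@le_trans _ _ (alpha R e * (2 * (#|V| - 1)%:R))).
  apply: ler_wpM2l; first exact: ltW alpha_gt0.
  by rewrite -natrM ler_nat; move: V_gt1; case: #|V| => [|[|m]] // _; lia.
rewrite mulrCA; apply: ler_wpM2l => //; apply: (le_trans av).
by rewrite ler_nat card_edge_cut_le.
Qed.

Lemma card_edge A : A \in edges e -> #|A| = 2.
Proof.
move=> /imsetP[[x y]]; rewrite inE /= => exy ->; rewrite cards2.
by have [xy|//] := eqVneq x y; rewrite xy e_irr in exy.
Qed.

(** Handshake: singleton cuts are degrees, each at most beta (n - 1), and their sum counts every
    edge twice. *)
Lemma card_edges_le : #|edges e|%:R <= beta R e * (#|V| * #|V|.-1)%:R / 2.
Proof.
have handshake : (\sum_v #|edge_cut e [set v]%SET| = 2 * #|edges e|)%N.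
  rewrite (eq_bigr (fun v => \sum_(A in edges e | v \in A) 1)%N); last first.
    move=> v _; rewrite sum1_card; apply: eq_card => A.
    rewrite inE -[RHS]/((A \in edges e) && (v \in A)); congr (_ && _).
    have [vA|vA] := boolP (v \in A).
      have -> : (A :&: [set v])%SET = [set v]%SET by apply/finset.setIidPr; rewrite finset.sub1set.
      by rewrite cards1.
    suff -> : (A :&: [set v])%SET = finset.set0 by rewrite cards0.
    by apply/setP => z; rewrite !inE; apply/negP => /andP[zA /eqP zv]; rewrite -zv zA in vA.
  rewrite (exchange_big_dep (mem (edges e))) /=; last by move=> v A _ /andP[].
  rewrite mulnC -sum_nat_const; apply: eq_bigr => A Ae.
  rewrite sum1_card -[RHS](card_edge Ae); apply: eq_card => v.
  by rewrite -[LHS]/((A \in edges e) && (v \in A)) Ae.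
rewrite ler_pdivlMr // -natrM mulnC -handshake natr_sum natrM.
rewrite mulrCA mulr_natl -sumr_const; apply: ler_sum => v _.
have [v0 vT] := vertex_cut v V_gt1.
have := cut_ratio_le_beta v0 vT.
by rewrite ler_pdivrMr ?ltr0n ?vol_gt0 // cards1 mul1n subn1.
Qed.

End CutParameters.

(** * Decay rate for exponential weights *)

Lemma one_minus_expRN_ge (R : realType) (x : R) : 0 <= x <= 1 ->
  x / 2 <= 1 - expR (- x).
Proof.
move=> /andP[x0 x1]; rewrite expRN.
have xp : 0 < 1 + x by lra.
have : (expR x)^-1 <= (1 + x)^-1 by rewrite lef_pV2 ?posrE ?expR_gt0 ?expR_ge1Dx.
suff : (1 + x)^-1 <= 1 - x / 2 by move: (_^-1) (_^-1) => a b; lra.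
rewrite -[leLHS]mul1r ler_pdivrMr //.
have : 0 <= x * (1 - x) by rewrite mulr_ge0 ?subr_ge0.
lra.
Qed.

Lemma inv_gap_ge (R : realType) (b : R) : 1 <= b ->
  (b * b)^-1 / 2 <= b^-1 - (b + 1)^-1.
Proof.
move=> b1; have b0 : 0 < b by lra.
rewrite (_ : _ - _ = (b * (b + 1))^-1); last by field; lra.
rewrite -invfM lef_pV2 ?posrE ?mulr_gt0 //; last by lra.
rewrite -mulrA ler_pM2l //; lra.
Qed.

Section Model.
Variables (R : realType) (V : finType) (e : rel V).
Hypothesis V_gt1 : (1 < #|V|)%N.
Hypothesis G_conn : simple_connected_graph e.
Variables (disp : measure_display) (T : measurableType disp).
Variables (P : probability T R) (w : {set V} -> {RV P >-> R}).
Hypothesis w_iid : iid_exp1_weights e w.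

Local Notation n := #|V|.

Lemma prob_weights_box (J : {set {set V}}) (B : {set V} -> set R) :
  J \subset edges e -> (forall A, measurable (B A)) ->
  P [set t | forall A, A \in J -> B A (w A t)] =
  (\prod_(A in J) exponential_prob (1 : R) (B A))%E.
Proof.
move=> Je mB; case: w_iid => /(_ J Je B mB) -> expw.
apply: eq_bigr => A AJ; rewrite -(expw A) //.
exact: (fintype.subsetP Je).
Qed.

Section Levels.
Variables (N : nat) (h : R).
Hypothesis h_ge0 : 0 <= h.

Definition levels (t : T) : {ffun {set V} -> 'I_N.+2} :=
  [ffun A => level N h (w A t)].

Lemma measurable_levels f : measurable (levels @^-1` [set f]).
Proof.
rewrite (_ : _ @^-1` _ = \bigcap_(A in [set: {set V}])
    (w A @^-1` [set x | level N h x == f A])); last first.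
  apply/seteqP; split=> t /=; first by move=> <- A _ /=; rewrite ffunE.
  by move=> tf; apply/ffunP => A; rewrite ffunE; apply/eqP; exact: tf.
apply: fin_bigcap_measurable; first exact: finite_finset.
move=> A _; rewrite -[X in measurable X]setTI; apply: measurable_funPT => //.
exact: measurable_level (pred1 (f A)).
Qed.

Definition level_weight (f : {ffun {set V} -> 'I_N.+2}) : R :=
  fine (P (levels @^-1` [set f])).

Lemma level_weightE f : (level_weight f)%:E = P (levels @^-1` [set f]).
Proof. by rewrite fineK // fin_num_measure //; exact: measurable_levels. Qed.

Lemma level_weight_ge0 f : 0 <= level_weight f.
Proof. by rewrite fine_ge0. Qed.

Definition level_law (Q : pred 'I_N.+2) : R :=
  fine (exponential_prob (1 : R) [set x | Q (level N h x)]).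

Lemma level_lawE Q :
  (level_law Q)%:E = exponential_prob (1 : R) [set x | Q (level N h x)].
Proof.
by rewrite fineK // (fin_num_measure (exponential_prob (1 : R))) //; exact: measurable_level.
Qed.

Lemma level_weight_box (J : {set {set V}}) (Q : {set V} -> pred 'I_N.+2) :
  J \subset edges e ->
  \sum_(f : {ffun {set V} -> 'I_N.+2} | [forall A in J, Q A (f A)]) level_weight f
    = \prod_(A in J) level_law (Q A).
Proof.
move=> Je; apply: EFin_inj.
rewrite -sumEFin (eq_bigr _ (fun f _ => level_weightE f)).
rewrite -(prob_finite_partition P
  (fun f : {ffun {set V} -> 'I_N.+2} => [forall A in J, Q A (f A)]) measurable_levels).
rewrite (_ : [set t | _] = [set t | forall A, A \in J -> [set x | Q A (level N h x)] (w A t)]).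
  rewrite (prob_weights_box Je (B := fun A => [set x | Q A (level N h x)])); last first.
    by move=> A; exact: measurable_level.
  by rewrite -prodEFin; apply: eq_bigr => A _; rewrite level_lawE.
apply/seteqP; split=> t /=.
  by move=> /forall_inP tQ A AJ; have := tQ A AJ; rewrite ffunE.
by move=> tQ; apply/forall_inP => A AJ; rewrite ffunE; exact: tQ.
Qed.

(** The tail beyond [c] grid steps has mass exp(-hc): memorylessness with [q = expR (- h)]. *)
Lemma level_law_tail c : (c < N)%N ->
  level_law (fun m => (c.+1 < m)%N) = expR (- h) * level_law (fun m => (c < m)%N).
Proof.
move=> cN.
have tail i : (i <= N)%N -> level_law (fun m => (i < m)%N) = expR (- (h * i%:R)).
  move=> iN; apply: EFin_inj; rewrite level_lawE -exponential_prob_gt ?mulr_ge0 //.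
  congr exponential_prob; apply/seteqP; split=> x /=;
    by rewrite in_itv /= andbT level_gt.
rewrite !tail // ?(ltnW cN) // -expRD; congr expR.
by rewrite -natr1; ring.
Qed.

(** A ball [U] with at most half of the vertices has at least alpha |U| n / 2 boundary edges, so it
    grows in one step with probability at least h alpha |U| n / 4; the inverse size then drops by at
    least 1/(2 |U|^2). The product is h alpha n / 8 times 1/|U|. *)
Lemma levels_decay v : h * #|edges e|%:R <= 1 ->
  \sum_(f : {ffun {set V} -> 'I_N.+2})
     level_weight f * inv_small R V #|ball e (fun A => f A : nat) v N|
  <= (1 - h * alpha R e * n%:R / 8) ^+ N.
Proof.
move=> hE; have a0 := alpha_gt0 R V_gt1 G_conn.
have cut_le U : h * #|edge_cut e U|%:R <= 1.
  by apply: le_trans hE; rewrite ler_wpM2l // ler_nat card_edge_cut_le.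
have [e_sym e_irr _] := G_conn.
apply: (ball_decay e_sym e_irr level_weight_ge0 level_weight_box level_law_tail) => //.
  rewrite divr_ge0 ?mulr_ge0 ?(ltW a0) //=.
  have := ler_wpM2l h_ge0 (alpha_mul_card_le R V_gt1 G_conn).
  rewrite mulrA mulrCA ler_pdivrMr // mul1r => /le_trans; apply.
  by apply: (@le_trans _ _ (2 * 1)); [rewrite ler_wpM2l | rewrite mulr1 ler_nat].
move=> U vU Us.
have U0 : (0 < #|U|)%N by apply/card_gt0P; exists v.
have U1 : U != finset.set0 by rewrite -card_gt0.
have UT : U \proper finset.setT.
  by rewrite properEcard finset.subsetT cardsT; apply: leq_trans Us; rewrite ltn_Pmull.
have := alpha_le R e U1 UT; set c := #|edge_cut e U| => ac.
have ac' : alpha R e * (#|U|%:R * n%:R / 2) <= c%:R.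
  apply: le_trans ac; apply: ler_wpM2l; first exact: ltW.
  rewrite natrM -mulrA; apply: ler_wpM2l => //; rewrite natrB ?max_card //.
  have : 2 * #|U|%:R <= n%:R :> R by rewrite -natrM ler_nat.
  lra.
have hc : 1 - expR (- h) ^+ c >= h * c%:R / 2.
  rewrite -expRM_natr mulNr; apply: one_minus_expRN_ge.
  by rewrite mulr_ge0 // cut_le.
have b0 : 0 < #|U|%:R :> R by rewrite ltr0n.
have b1 : 1 <= #|U|%:R :> R by rewrite ler1n.
have gap : (#|U|%:R * #|U|%:R)^-1 / 2 <= inv_small R V #|U| - inv_small R V #|U|.+1.
  have -> : inv_small R V #|U| = #|U|%:R^-1 by rewrite /inv_small Us.
  have : inv_small R V #|U|.+1 <= #|U|.+1%:R^-1.
    by rewrite /inv_small; case: ifP.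
  by move=> small; apply: (le_trans (inv_gap_ge b1)); rewrite natr1 lerD2l lerN2.
have -> : inv_small R V #|U| = #|U|%:R^-1 by rewrite /inv_small Us.
rewrite (_ : inv_small R V #|U| = #|U|%:R^-1) in gap; last by rewrite /inv_small Us.
apply: (@le_trans _ _ ((h * (alpha R e * (#|U|%:R * n%:R / 2)) / 2) * ((#|U|%:R * #|U|%:R)^-1 / 2))).
  by rewrite le_eqVlt; apply/orP; left; apply/eqP; field; rewrite gt_eqF.
apply: ler_pM.
- by rewrite divr_ge0 // !mulr_ge0 // ltW.
- by rewrite divr_ge0 // invr_ge0 mulr_ge0.
- by apply: le_trans hc; rewrite ler_pM2r ?invr_gt0 //; exact: ler_wpM2l.
- exact: gap.
Qed.

End Levels.

End Model.

(** * Functions of a finitely valued map *)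

Section FiniteRange.
Variables (disp : measure_display) (T : measurableType disp) (R : realType).
Variable P : probability T R.
Variables (F : finType) (K : T -> F).
Hypothesis mK : forall f, measurable (K @^-1` [set f]).

Lemma measurable_finite_range (y : F -> R) :
  measurable_fun setT (fun t => y (K t)).
Proof.
move=> _ Y mY; rewrite setTI.
rewrite (_ : _ @^-1` _ = \bigcup_(f in [set f | Y (y f)]) (K @^-1` [set f])).
  by apply: fin_bigcup_measurable => [|f _]; [exact: finite_finset | exact: mK].
apply/seteqP; split=> [t /= Yt|t [f /= Yf tf]]; first by exists (K t).
by rewrite /= tf.
Qed.

Lemma integral_finite_range (y : F -> R) : (forall f, 0 <= y f) ->
  (\int[P]_t (y (K t))%:E = \sum_f (y f)%:E * P (K @^-1` [set f]))%E.
Proof.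
move=> y0.
transitivity (\int[P]_t (\sum_f (y f)%:E * (\1_(K @^-1` [set f]) t)%:E))%E.
  apply: eq_integral => t _; rewrite (bigD1 (K t)) //= indicE mem_set // mule1.
  rewrite big1 ?adde0 // => f fK; rewrite indicE memNset ?mule0 //= => Kt.
  by rewrite Kt eqxx in fK.
have m1 f : measurable_fun setT (fun t => (\1_(K @^-1` [set f]) t)%:E : \bar R).
  by apply/measurable_EFinP; exact: measurable_indic.
rewrite ge0_integral_sum //; last 2 first.
- by move=> f; apply: emeasurable_funM => //; exact: measurable_cst.
- by move=> f t _; rewrite mule_ge0 // lee_fin.
apply: eq_bigr => f _; rewrite ge0_integralZl_EFin // ?integral_indic ?setIT //.
Qed.

End FiniteRange.

Lemma sum_geometric_le (R : realType) (a k : R) : 0 <= a -> 0 <= k < 1 ->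
  (\sum_(0 <= j <oo) (a * k ^+ j)%:E <= (a / (1 - k))%:E)%E.
Proof.
move=> a0 /andP[k0 k1]; apply: lime_le.
  by apply: is_cvg_nneseries => j _ _; rewrite lee_fin mulr_ge0 ?exprn_ge0.
apply: nearW => m; rewrite sumEFin lee_fin -mulr_sumr; apply: ler_wpM2l => //.
have k1' : 0 < 1 - k by lra.
rewrite -[leRHS]mul1r ler_pdivlMr // mulr_suml big_mkord.
rewrite (eq_bigr (fun i : 'I_m => k ^+ i - k ^+ i.+1)); last by move=> i _; rewrite exprS; ring.
have -> : \sum_(i < m) (k ^+ i - k ^+ i.+1) = 1 - k ^+ m.
  elim: m => [|m IH]; first by rewrite big_ord0 expr0 subrr.
  by rewrite big_ord_recr /= IH; ring.
by rewrite gerBl exprn_ge0.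
Qed.

(** * Nearest-neighbor tours *)

Section NearestNeighbor.
Variables (R : realType) (V : finType) (e : rel V).
Hypothesis V_gt1 : (1 < #|V|)%N.
Hypothesis G_conn : simple_connected_graph e.
Variables (disp : measure_display) (T : measurableType disp).
Variables (P : probability T R) (w : {set V} -> {RV P >-> R}).
Hypothesis w_iid : iid_exp1_weights e w.
Variables (h k : R).
Hypothesis h_gt0 : 0 < h.
Hypothesis h_le : h * #|edges e|%:R <= 1.
Hypothesis k_bounds : 0 < k < 1.
Hypothesis k_decay : 0 <= 1 - h * alpha R e * #|V|%:R / 8 <= k ^+ 2.

Local Notation n := #|V|.
Local Notation dist t := (sp_dist e (fun A => w A t)).
Local Notation gball j f v := (ball e (fun A => f A : nat) v j).

(** The bound of [long_steps_le] at D = 2hj with [th = k ^+ j]. By [k_decay] the sum over balls has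
    mean at most n k^(2j), so both terms have mean at most n k^j / 2. *)
Definition long_steps_bound (j : nat) (f : {ffun {set V} -> 'I_j.+2}) : R :=
  k ^+ j / 2 * n%:R + (2 * k ^+ j)^-1 * \sum_v inv_small R V #|gball j f v|.

(** The factor 4h is the layer height 2h times 2 for the closing step. The series is infinite
    because step lengths have no deterministic bound; scale [j] uses the discretisation truncated at
    [j]. *)
Definition nn_bound (t : T) : \bar R :=
  (\sum_(0 <= j <oo) (4 * h * long_steps_bound (levels w j h t))%:E)%E.

Let k_gt0 : 0 < k. Proof. by case/andP: k_bounds. Qed.

Lemma long_steps_bound_ge0 j f : 0 <= 4 * h * @long_steps_bound j f.
Proof.
rewrite mulr_ge0 ?mulr_ge0 ?(ltW h_gt0) //; apply: addr_ge0.
  by rewrite mulr_ge0 // divr_ge0 // exprn_ge0 // ltW.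
rewrite mulr_ge0 ?invr_ge0 ?mulr_ge0 ?exprn_ge0 ?(ltW k_gt0) //.
by apply: sumr_ge0 => v _; exact: inv_small_ge0.
Qed.

Lemma nn_bound_ge0 t : (0 <= nn_bound t)%E.
Proof. by apply: nneseries_ge0 => j _ _; rewrite lee_fin long_steps_bound_ge0. Qed.

Let measurable_term j :
  measurable_fun setT (fun t => (4 * h * long_steps_bound (levels w j h t))%:E).
Proof.
apply/measurable_EFinP.
exact: (measurable_finite_range (measurable_levels w (ltW h_gt0))
  (fun f => 4 * h * long_steps_bound f)).
Qed.

Lemma measurable_nn_bound : measurable_fun setT nn_bound.
Proof.
apply: ge0_emeasurable_sum => [j t _ _|j _]; last exact: measurable_term.
by rewrite lee_fin long_steps_bound_ge0.
Qed.

Lemma integral_long_steps_bound j :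
  (\int[P]_t (4 * h * long_steps_bound (levels w j h t))%:E
    <= (4 * h * n%:R * k ^+ j)%:E)%E.
Proof.
have h0 := ltW h_gt0; have kj : 0 < k ^+ j by rewrite exprn_gt0.
rewrite (integral_finite_range P (measurable_levels w h0)
  (y := fun f : {ffun {set V} -> 'I_j.+2} => 4 * h * long_steps_bound f)); last first.
  by move=> f; exact: long_steps_bound_ge0.
rewrite (eq_bigr (fun f : {ffun {set V} -> 'I_j.+2} =>
    (4 * h * long_steps_bound f * level_weight w h f)%:E)); last first.
  by move=> f _; rewrite -(level_weightE w h0) -EFinM.
rewrite sumEFin lee_fin.
have tot : \sum_(f : {ffun {set V} -> 'I_j.+2}) level_weight w h f = 1.
  exact: W_total (level_weight_box w_iid h0).
have decay v : \sum_(f : {ffun {set V} -> 'I_j.+2})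
    level_weight w h f * inv_small R V #|gball j f v| <= k ^+ j * k ^+ j.
  apply: (le_trans (levels_decay V_gt1 G_conn w_iid j h0 v h_le)).
  rewrite -expr2 -exprM mulnC exprM; case/andP: k_decay => decay0 decay1.
  by apply: lerXn2r => //; rewrite nnegrE exprn_ge0 // ltW.
rewrite (eq_bigr (fun f : {ffun {set V} -> 'I_j.+2} => 2 * h * k ^+ j * n%:R * level_weight w h f +
    2 * h / k ^+ j * \sum_v level_weight w h f * inv_small R V #|gball j f v|)); last first.
  move=> f _; rewrite -mulr_sumr /long_steps_bound; field; exact: lt0r_neq0.
rewrite big_split /= -!mulr_sumr tot mulr1 exchange_big /=.
apply: (@le_trans _ _ (2 * h * k ^+ j * n%:R + 2 * h / k ^+ j * \sum_(v : V) k ^+ j * k ^+ j)).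
  rewrite lerD2l; apply: ler_wpM2l; last by apply: ler_sum => v _; exact: decay.
  by rewrite divr_ge0 ?mulr_ge0 // ltW.
rewrite sumr_const -mulr_natr le_eqVlt; apply/orP; left; apply/eqP.
field; exact: lt0r_neq0.
Qed.

Lemma integral_nn_bound :
  (\int[P]_t nn_bound t <= (4 * h * n%:R / (1 - k))%:E)%E.
Proof.
rewrite integral_nneseries //; last by move=> j t _; rewrite lee_fin long_steps_bound_ge0.
apply: (@le_trans _ _ (\sum_(0 <= j <oo) (4 * h * n%:R * k ^+ j)%:E)%E).
  apply: lee_nneseries => j _ *; last exact: integral_long_steps_bound.
  by apply: integral_ge0 => t _; rewrite lee_fin long_steps_bound_ge0.
apply: sum_geometric_le; first by rewrite !mulr_ge0 // ltW.
by case/andP: k_bounds => k0 ->; rewrite ltW.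
Qed.

Lemma nn_tour_le t s : (forall A, A \in edges e -> 0 <= w A t) ->
  is_nn_tour (dist t) s -> ((tour_length (dist t) s)%:E <= nn_bound t)%E.
Proof.
move=> w0 nn_s; have [e_sym e_irr e_conn] := G_conn.
have [tour_s _] := nn_s.
case: s => [|x p] in nn_s tour_s *; first exact: nn_bound_ge0.
have d0 := sp_dist_ge0 e_conn w0; have d_refl := sp_dist_refl e_conn w0.
have d_sym := sp_dist_sym e_sym e_conn w0; have d_tri := sp_dist_triangle e_conn w0.
set ds := pairmap (dist t) x p.
have ds0 c : c \in ds -> 0 <= c.
  rewrite /ds; elim: p x {nn_s tour_s ds} => //= y p IH x.
  by rewrite inE => /predU1P[->|/IH//]; exact: d0.
(* A cutoff depending on the outcome: no step exceeds 2hJ. *)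
pose J := Num.bound (walk_cost (dist t) x p / (2 * h)).
have h2 : 0 < 2 * h by rewrite mulr_gt0.
have dsJ c : c \in ds -> 0 <= c <= 2 * h * J%:R.
  move=> cds; rewrite ds0 //=; apply: (@le_trans _ _ (walk_cost (dist t) x p)).
    rewrite /walk_cost -/ds (big_rem c) //= lerDl big_seq sumr_ge0 // => c' c'ds.
    exact: ds0 (mem_rem c'ds).
  rewrite mulrC -ler_pdivrMr //; apply: ltW; apply: archi_boundP.
  rewrite divr_ge0 ?(ltW h2) // /walk_cost -/ds big_seq sumr_ge0 // => c' c'ds; exact: ds0.
apply: (@le_trans _ _ (\sum_(0 <= j < J) (4 * h * long_steps_bound (levels w j h t))%:E)%E);
  last by apply: nneseries_lim_ge => j _ _; rewrite lee_fin long_steps_bound_ge0.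
rewrite sumEFin lee_fin; apply: (le_trans (tour_length_le2 d0 d_refl d_sym d_tri x p)).
rewrite /walk_cost -/ds; apply: (@le_trans _ _ (2 *
    \sum_(j < J) 2 * h * (count (fun c => (2 * h * j%:R < c)%R) ds)%:R)).
  by rewrite ler_pM2l // sum_le_layers.
rewrite mulr_sumr big_mkord; apply: ler_sum => j _.
rewrite (_ : 4 * h * _ = 2 * (2 * h * long_steps_bound (levels w j h t))); last by ring.
rewrite ler_pM2l // ler_pM2l //; apply: long_steps_le => //.
- by rewrite exprn_gt0.
- by move=> v; exact: mem_ball.
- move=> v y yb; rewrite (_ : _ / 2 = h * j%:R); last by field.
  apply: (sp_dist_ball w0 _ (ltW h_gt0) yb) => A _ kj.
  by rewrite ffunE in kj *; apply: level_le kj; [exact: ltW | exact: leqnn].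
Qed.

End NearestNeighbor.

(** * Lower tail of the shortest tour *)

(** The falling factorial of 2k with k factors lies in between: each factor is at least k, and it
    equals the central binomial coefficient, at most 4^k, times k!. *)
Lemma expn_le_fact k : (k ^ k <= 4 ^ k * k`!)%N.
Proof.
have ffact_ge m : (k ^ m <= (m + k) ^_ m)%N.
  elim: m => [//|m IH]; rewrite addSn ffactSS expnS.
  by rewrite leq_mul // leqW // leq_addl.
apply: leq_trans (ffact_ge k) _; rewrite -bin_ffact leq_mul2r; apply/orP; right.
have bin_le m i : ('C(m, i) <= 2 ^ m)%N.
  elim: m i => [|m IH] [|i]; rewrite ?bin0 ?expn_gt0 ?bin0n // binS expnS mul2n -addnn.
  exact: leq_add.
by rewrite (leq_trans (bin_le _ _)) // addnn -muln2 mulnC expnM.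
Qed.

(** Chain: C(m,k) x^k <= (mx)^k / k! <= (k/8)^k / k! <= (4/8)^k, the last step by [expn_le_fact]. *)
Lemma bin_mul_expr_le (R : realFieldType) (m k : nat) (x : R) : 0 <= x ->
  m%:R * x <= k%:R / 8 -> 'C(m, k)%:R * x ^+ k <= 2^-1 ^+ k.
Proof.
move=> x0 mx.
have kf : 0 < k`!%:R :> R by rewrite ltr0n fact_gt0.
rewrite -(ler_pM2r kf) mulrAC -natrM bin_ffact.
apply: (@le_trans _ _ ((m%:R * x) ^+ k)).
  rewrite exprMn ler_wpM2r ?exprn_ge0 // -natrX ler_nat.
  by elim: k {mx kf} => // k IH; rewrite ffactnSr expnSr leq_mul // leq_subr.
apply: (@le_trans _ _ ((k%:R / 8) ^+ k)).
  by apply: lerXn2r; rewrite // nnegrE ?mulr_ge0 ?divr_ge0.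
rewrite (_ : 8 = 4 * 2); last by ring.
rewrite invfM mulrA exprMn mulrC; apply: ler_wpM2l.
  by rewrite exprn_ge0 // invr_ge0.
rewrite exprMn exprVn ler_pdivrMr ?exprn_gt0 // -!natrX -natrM ler_nat mulnC.
exact: expn_le_fact.
Qed.

Section Ratio.
Variables (R : realType) (V : finType) (e : rel V).
Hypothesis V_gt1 : (1 < #|V|)%N.
Hypothesis G_conn : simple_connected_graph e.
Variables (disp : measure_display) (T : measurableType disp).
Variables (P : probability T R) (w : {set V} -> {RV P >-> R}).
Hypothesis w_iid : iid_exp1_weights e w.

Local Notation n := #|V|.
Local Notation dist t := (sp_dist e (fun A => w A t)).

Definition nonneg_weights : set T :=
  [set t | forall A, A \in edges e -> (`[0, +oo[%classic : set R) (w A t)].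

Definition light (x : R) (J : {set {set V}}) : set T :=
  [set t | forall A, A \in J -> (`]-oo, x[%classic : set R) (w A t)].

Lemma measurable_weights_box (J : {set {set V}}) (B : set R) : measurable B ->
  measurable [set t | forall A, A \in J -> B (w A t)].
Proof.
move=> mB; rewrite (_ : mkset _ = \bigcap_(A in [set` J]) (w A @^-1` B)) //.
apply: fin_bigcap_measurable => [|A _]; first exact: finite_finset.
by rewrite -[X in measurable X]setTI; exact: measurable_funPT.
Qed.

Lemma prob_nonneg_weights : P nonneg_weights = 1%E.
Proof.
rewrite (prob_weights_box w_iid (B := fun=> `[0, +oo[%classic)) //.
apply: big1 => A _.
have -> : `[0, +oo[%classic = ~` `]-oo, 0[%classic :> set R by rewrite setCitvl.
rewrite (probability_setC (exponential_prob (1 : R))) //.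
by rewrite [X in (_ - X)%E]exponential_prob_lt0 sube0.
Qed.

Lemma prob_light_le x (J : {set {set V}}) : 0 <= x -> J \subset edges e ->
  (P (light x J) <= (x ^+ #|J|)%:E)%E.
Proof.
move=> x0 Je; rewrite (prob_weights_box w_iid (B := fun=> `]-oo, x[%classic)) //.
rewrite -prodr_const.
have /andP[] // : (0 <= \prod_(A in J) exponential_prob (1 : R) `]-oo, x[%classic
    <= (\prod_(A in J) x)%:E)%E.
apply: (big_ind2 (fun (a : \bar R) (b : R) => (0 <= a <= b%:E)%E)).
- by rewrite lee01 lexx.
- move=> a b a' b' /andP[a0 ab] /andP[a'0 ab']; rewrite mule_ge0 //= EFinM.
  exact: lee_pmul.
- by move=> A _; rewrite exponential_prob_lt // andbT (measure_ge0 (exponential_prob (1 : R))).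
Qed.

(* A vertex that touches no light edge is at distance at least [x] from all the
   others, and the light edges touch at most twice as many vertices. *)
Lemma tsp_ge_of_few_light t x k : 0 <= x -> nonneg_weights t ->
  (4 * k <= n + 3)%N ->
  (forall J : {set {set V}}, J \subset edges e -> #|J| = k -> ~ light x J t) ->
  x * n%:R / 2 <= tsp_length (dist t).
Proof.
move=> x0 t0 k4 few; have [e_sym e_irr e_conn] := G_conn.
have w0 A : A \in edges e -> 0 <= w A t.
  by move=> /t0 /=; rewrite in_itv /= andbT.
pose M := [set A in edges e | w A t < x]%SET.
have Mk : (#|M| < k)%N.
  rewrite ltnNge; apply/negP => kM.
  pose J := [set A in take k (enum M)]%SET.
  have JM A : A \in J -> A \in M by rewrite inE => /mem_take; rewrite mem_enum.
  apply: (few J).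
  - by apply/fintype.subsetP => A /JM; rewrite inE => /andP[].
  - rewrite cardsE (card_uniqP _) ?take_uniq ?enum_uniq // size_takel // -cardE //.
  - by move=> A /JM /=; rewrite inE in_itv /= => /andP[].
have cM : (#|finset.cover M| <= 2 * #|M|)%N.
  apply: leq_trans (leq_card_cover M) _; rewrite mulnC -sum_nat_const.
  apply: leq_sum => A; rewrite inE => /andP[Ae _].
  by rewrite (card_edge G_conn Ae).
pose m v : R := if v \in finset.cover M then 0 else x.
apply: (@le_trans _ _ (\sum_v m v)).
  rewrite /m (bigID (mem (finset.cover M))) /= big1 ?add0r; last by move=> v ->.
  rewrite (eq_bigr (fun=> x)); last by move=> v /negbTE ->.
  rewrite sumr_const -[x *+ _]mulr_natr -mulrA; apply: ler_wpM2l => //.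
  (* At most k - 1 light edges touch at most 2(k - 1) <= (n - 1)/2 vertices. *)
  have : (n <= 2 * #|[predC finset.cover M]|)%N.
    have := cardC (mem (finset.cover M)); move: cM Mk k4.
    by move: #|[predC _]| #|finset.cover M| #|M| n => a b c n'; lia.
  by rewrite -(ler_nat R) natrM; move: (#|_|%:R) (#|_|%:R) => a b; lra.
apply: tsp_length_ge_nearest => //.
move=> u v uv; rewrite /m; case: ifPn => [_|uM]; first exact: sp_dist_ge0.
  apply: sp_dist_ge_nearest => // A Ae uA; rewrite leNgt; apply: contra uM => Ax.
  by apply/bigcupP; exists A; rewrite // inE Ae.
Qed.

End Ratio.

(** * Choice of constants and assembly *)

Lemma half_rate_bounds (R : realFieldType) (y : R) : 0 < y <= 2 ->
  0 < 1 - y / 16 < 1 /\ 0 <= 1 - y / 8 <= (1 - y / 16) ^+ 2.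
Proof.
move=> /andP[y0 y2]; have : 0 <= y * y by rewrite mulr_ge0 // ltW.
by rewrite expr2; split; apply/andP; split; lra.
Qed.

Lemma edge_mass_arith (R : realFieldType) (b n n' k : R) :
  b * n * n' <= b * n * (4 * k) -> b * (n * n') / 2 <= k / 8 * (16 * b * n).
Proof. lra. Qed.

Section Assembly.
Variables (R : realType) (V : finType) (e : rel V).
Hypothesis V_gt1 : (1 < #|V|)%N.
Hypothesis G_conn : simple_connected_graph e.
Variables (disp : measure_display) (T : measurableType disp).
Variables (P : probability T R) (w : {set V} -> {RV P >-> R}).
Hypothesis w_iid : iid_exp1_weights e w.

Local Notation n := #|V|.
Local Notation dist t := (sp_dist e (fun A => w A t)).

Let a_gt0 : 0 < alpha R e. Proof. exact: alpha_gt0. Qed.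
Let b_gt0 : 0 < beta R e. Proof. exact: lt_le_trans a_gt0 (alpha_le_beta _ _ _). Qed.
Let n_gt0 : 0 < n%:R :> R. Proof. by rewrite ltr0n ltnW. Qed.

(** One measurable majorant covers all starting vertices and tie-breaking rules at once, and serves
    again for the ratio. *)
Lemma nn_domination : exists g : T -> \bar R,
  [/\ measurable_fun setT g, (forall t, 0 <= g t)%E,
      (\int[P]_t g t <= (64 / alpha R e)%:E)%E &
      forall t s, nonneg_weights e w t -> is_nn_tour (dist t) s ->
        ((tour_length (dist t) s)%:E <= g t)%E].
Proof.
pose h : R := #|edges e|.+1%:R^-1.
have h_gt0 : 0 < h by rewrite invr_gt0.
have hE : h * #|edges e|%:R <= 1.
  by rewrite mulrC ler_pdivrMr // mul1r ler_nat.
pose y := h * alpha R e * n%:R.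
have y_gt0 : 0 < y by rewrite !mulr_gt0.
have y_le2 : y <= 2.
  have := ler_wpM2l (ltW h_gt0) (alpha_mul_card_le R V_gt1 G_conn).
  rewrite mulrA mulrCA => /le_trans; apply.
  by rewrite -[leRHS]mulr1 ler_wpM2l.
(* With scale ratio 1 - y/16, the square 1 - y/8 + y^2/256 dominates the one-step decay 1 - y/8. *)
have [kb kd] : 0 < 1 - y / 16 < 1 /\ 0 <= 1 - y / 8 <= (1 - y / 16) ^+ 2.
  by apply: half_rate_bounds; rewrite y_gt0.
(* The grid step cancels: 4hn is divided by h alpha n / 16. *)
have kE : 4 * h * n%:R / (1 - (1 - y / 16)) = 64 / alpha R e.
  by rewrite opprB addrC subrK /y; field; rewrite !gt_eqF.
exists (nn_bound e w h (1 - y / 16)); split.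
- exact: measurable_nn_bound.
- by move=> t; exact: nn_bound_ge0.
- by rewrite -kE; exact: integral_nn_bound.
- move=> t s t0; apply: nn_tour_le => // A Ae.
  by have := t0 A Ae; rewrite /= in_itv /= andbT.
Qed.

(** [k] is n/4 rounded up; the threshold [x] for light edges is chosen so that x n / 2 = 1/(32
    beta). *)
Let k := ((n + 3) %/ 4)%N.
Let x : R := (16 * beta R e * n%:R)^-1.

Let n_le : (n <= 4 * k)%N. Proof. rewrite /k; lia. Qed.
Let k_le : (4 * k <= n + 3)%N. Proof. rewrite /k; lia. Qed.
Let x_gt0 : 0 < x. Proof. by rewrite invr_gt0 !mulr_gt0. Qed.

(** Ratio 2n times the union bound over [k]-sets of edges. Since |E| x <= (n - 1)/32 <= k/8, the
    union bound is at most 2^-k, and 8k 2^-k <= 8. *)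
Lemma light_mass_le : 2 * n%:R * ('C(#|edges e|, k)%:R * x ^+ k) <= 8.
Proof.
have nk : n%:R <= 4 * k%:R :> R by rewrite -natrM ler_nat.
have mx : #|edges e|%:R * x <= k%:R / 8.
  rewrite /x ler_pdivrMr ?mulr_gt0 //; apply: (le_trans (card_edges_le R V_gt1 G_conn)).
  rewrite natrM; have : n.-1%:R <= 4 * k%:R :> R.
    by apply: le_trans nk; rewrite ler_nat leq_pred.
  move: (n.-1%:R) => n' n'k.
  have : beta R e * n%:R * n' <= beta R e * n%:R * (4 * k%:R).
    by rewrite ler_wpM2l // mulr_ge0 ?ltW.
  exact: edge_mass_arith.
apply: (@le_trans _ _ (2 * (4 * k%:R) * 2^-1 ^+ k)).
  apply: ler_pM.
  - by rewrite mulr_ge0.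
  - by rewrite mulr_ge0 ?exprn_ge0 // ltW.
  - by rewrite ler_wpM2l.
  - by apply: bin_mul_expr_le => //; exact: ltW.
rewrite exprVn ler_pdivrMr ?exprn_gt0 // mulrA -natrM.
apply: ler_wpM2l => //; rewrite -natrX ler_nat; exact: ltnW (ltn_expl k _).
Qed.

(** If no [k] edges are light, the shortest tour is at least 1/(32 beta); otherwise the ratio is at
    most 2n, paid by an indicator for each [k]-set. The constant is 32 times 64 plus 8, the 8 being
    absorbed by beta / alpha >= 1. *)
Lemma ratio_domination (g : T -> \bar R) : measurable_fun setT g ->
  (forall t, 0 <= g t)%E -> (\int[P]_t g t <= (64 / alpha R e)%:E)%E ->
  (forall t s, nonneg_weights e w t -> is_nn_tour (dist t) s ->
    ((tour_length (dist t) s)%:E <= g t)%E) ->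
  exists g' : T -> \bar R,
  [/\ measurable_fun setT g', (forall t, 0 <= g' t)%E,
      (\int[P]_t g' t <= (2056 * (beta R e / alpha R e))%:E)%E &
      forall t s, nonneg_weights e w t -> is_nn_tour (dist t) s ->
        ((tour_length (dist t) s / tsp_length (dist t))%:E <= g' t)%E].
Proof.
move=> mg g0 gI gnn; have [e_sym e_irr e_conn] := G_conn.
pose s := enum [set J : {set {set V}} | J \subset edges e & #|J| == k]%SET.
have sP J : J \in s -> J \subset edges e /\ #|J| = k.
  by rewrite mem_enum inE => /andP[? /eqP].
pose big (J : {set {set V}}) t := ((2 * n%:R)%:E * (\1_(light w x J) t)%:E)%E : \bar R.
have mlight J : measurable (light w x J) by exact: measurable_weights_box.
have n2 : 0 <= 2 * n%:R :> R by rewrite mulr_ge0.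
have big0 J t : (0 <= big J t)%E by rewrite mule_ge0 // lee_fin.
have m1 J : measurable_fun setT (fun t => (\1_(light w x J) t)%:E : \bar R).
  by apply/measurable_EFinP; exact: measurable_indic.
have mbig J : measurable_fun setT (big J).
  by apply: emeasurable_funM => //; exact: measurable_cst.
have b32 : 0 <= 32 * beta R e by rewrite mulr_ge0 // ltW.
have b32e : (0 <= (32 * beta R e)%:E)%E by rewrite lee_fin.
have bg0 t : (0 <= (32 * beta R e)%:E * g t)%E by rewrite mule_ge0.
have mbg : measurable_fun setT (fun t => (32 * beta R e)%:E * g t)%E.
  by apply: emeasurable_funM => //; exact: measurable_cst.
exists (fun t => (32 * beta R e)%:E * g t + \sum_(J <- s) big J t)%E; split.
- by apply: emeasurable_funD => //; exact: emeasurable_sum.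
- by move=> t; rewrite adde_ge0 // sume_ge0.
- rewrite ge0_integralD //; last 2 first.
  + by move=> t _; exact: sume_ge0.
  + exact: emeasurable_sum.
  rewrite ge0_integralZl_EFin // ge0_integral_sum //.
  apply: (@le_trans _ _ ((32 * beta R e)%:E * (64 / alpha R e)%:E + (8 : R)%:E)%E).
    apply: leeD; first exact: (lee_wpmul2l b32e gI).
    apply: (@le_trans _ _ (\sum_(J <- s) (2 * n%:R * x ^+ k)%:E)%E).
      rewrite big_seq [leRHS]big_seq; apply: lee_sum => J /sP[Je Jk].
      rewrite ge0_integralZl_EFin // integral_indic // setIT EFinM.
      have n2e : (0 <= (2 * n%:R)%:E :> \bar R)%E by rewrite lee_fin.
      by rewrite -Jk; apply: (lee_wpmul2l n2e (prob_light_le w_iid (ltW x_gt0) Je)).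
    rewrite sumEFin lee_fin big_const_seq count_predT iter_addr_0 -cardE cards_draws.
    by rewrite -[leLHS]mulr_natl mulrCA; exact: light_mass_le.
  rewrite -EFinM -EFinD lee_fin.
  have : 1 <= beta R e / alpha R e by rewrite ler_pdivlMr // mul1r; exact: alpha_le_beta.
  rewrite (_ : 32 * _ * _ = 2048 * (beta R e / alpha R e)); last by ring.
  by move: (_ / _) => r; lra.
- move=> t sq t0 nn_s; have [tour_s _] := nn_s.
  have w0 A : A \in edges e -> 0 <= w A t.
    by move=> /t0 /=; rewrite in_itv /= andbT.
  have d0 := sp_dist_ge0 e_conn w0; have d_refl := sp_dist_refl e_conn w0.
  have d_sym := sp_dist_sym e_sym e_conn w0; have d_tri := sp_dist_triangle e_conn w0.
  have tsp0 : 0 <= tsp_length (dist t) by exact: tsp_length_ge0.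
  have [[J [JE Jk] lJ]|no_light] :=
      pselect (exists2 J : {set {set V}}, J \subset edges e /\ #|J| = k & light w x J t).
    have Js : J \in s by rewrite mem_enum inE JE Jk eqxx.
    have bigJ : big J t = (2 * n%:R)%:E by rewrite /big indicE mem_set // mule1.
    apply: (@le_trans _ _ (\sum_(J <- s) big J t)%E); last by rewrite leeDr.
    apply: (@le_trans _ _ (big J t)); last by rewrite (big_rem J) //= leeDl // sume_ge0.
    (* For a shortest tour of length 0, division by zero makes the ratio 0. *)
    rewrite bigJ lee_fin; have [->|tsp_neq0] := eqVneq (tsp_length (dist t)) 0.
      by rewrite invr0 mulr0.
    rewrite ler_pdivrMr ?lt_neqAle ?tsp0 1?eq_sym ?tsp_neq0 //.
    exact: tour_length_le_tsp.
  have tsp_ge : (32 * beta R e)^-1 <= tsp_length (dist t).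
    have : x * n%:R / 2 <= tsp_length (dist t).
      apply: (tsp_ge_of_few_light V_gt1 G_conn (ltW x_gt0) t0 k_le) => J JE Jk lJ.
      by apply: no_light; exists J.
    by apply: le_trans; rewrite /x le_eqVlt; apply/orP; left; apply/eqP; field; rewrite !gt_eqF.
  have tsp_gt0 : 0 < tsp_length (dist t).
    by apply: lt_le_trans tsp_ge; rewrite invr_gt0 mulr_gt0.
  have tour0 : 0 <= tour_length (dist t) sq.
    by case: (sq) => [//|z p]; exact: walk_cost_dist_ge0.
  apply: (@le_trans _ _ ((32 * beta R e)%:E * g t)%E); last by rewrite leeDl // sume_ge0.
  apply: (@le_trans _ _ ((32 * beta R e)%:E * (tour_length (dist t) sq)%:E)%E); last first.
    exact: (lee_wpmul2l b32e (gnn _ _ t0 nn_s)).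
  rewrite -EFinM lee_fin mulrC; apply: ler_wpM2r => //.
  by rewrite -[leRHS]invrK lef_pV2 // posrE ?invr_gt0 ?mulr_gt0.
Qed.

End Assembly.

(* [tour t] is the tour computed by the heuristic on outcome t; starting vertex
   and tie-breaking are arbitrary, subject to [tour] being a random variable. *)
Theorem theorem4 (R : realType) :
  exists C : R, 0 < C /\
  forall (V : finType) (e : rel V),
    (1 < #|V|)%N -> simple_connected_graph e ->
  forall (disp : measure_display) (T : measurableType disp)
    (P : probability T R) (w : {set V} -> {RV P >-> R}),
    iid_exp1_weights e w ->
  let dist := fun (t : T) => sp_dist e (fun A => w A t) in
  forall tour : T -> seq V,
    (forall s : seq V, measurable (tour @^-1` [set s])) ->
    (forall t : T, is_nn_tour (dist t) (tour t)) ->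
  let NN := fun t : T => tour_length (dist t) (tour t) in
  let TSP := fun t : T => tsp_length (dist t) in
    ('E_P[NN] <= (C * (1 / alpha R e))%:E)%E /\
    ('E_P[fun t => (NN t / TSP t)%R] <= (C * (beta R e / alpha R e))%:E)%E.
Proof.
exists 2056; split; first by rewrite ltr0n.
move=> V e V_gt1 G_conn disp T P w w_iid dist tour _ nn_tour NN TSP.
(* The pointwise bounds hold for nonnegative weights, that is, outside a null set. *)
have mnull : measurable (~` nonneg_weights e w).
  by apply: measurableC; exact: measurable_weights_box.
have null0 : P (~` nonneg_weights e w) = 0%E.
  rewrite probability_setC; last exact: measurable_weights_box.
  by rewrite prob_nonneg_weights // subee.
have [g [mg g0 gI gnn]] := nn_domination V_gt1 G_conn w_iid.
have [g' [mg' g'0 g'I g'nn]] := ratio_domination V_gt1 G_conn w_iid mg g0 gI gnn.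
split; [apply: le_trans (_ : _ <= \int[P]_t g t)%E _ | apply: le_trans g'I].
- apply: (expectation_le_ae mnull null0 mg g0) => t /contrapT t0.
  exact: gnn t0 (nn_tour t).
- apply: (le_trans gI); rewrite lee_fin mul1r ler_wpM2r ?invr_ge0 ?ler_nat //.
  exact: ltW (alpha_gt0 R V_gt1 G_conn).
- apply: (expectation_le_ae mnull null0 mg' g'0) => t /contrapT t0.
  exact: g'nn t0 (nn_tour t).
Qed.
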